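(* The following decision problem is in NP: given a finite, $\mathcal{X}$-labeled prime event structure $\mathcal{E}$ and a word $w\in\mathcal{X}^*$, decide whether $w\in\mathcal{L}(\mathcal{E})$.
   Context: A finite $\mathcal{X}$-labeled prime event structure (FLES) is a tuple $\mathcal{E}=\langle E,<,\#,h\rangle$ where $E$ is a finite set of events, $<\subseteq E\times E$ is a strict partial order (causality), $h:E\to\mathcal{X}$ is a labeling, and $\#\subseteq E\times E$ is a symmetric, irreflexive conflict relation that is closed under $<$ (if $e\#e'$ and $e'<e''$ then $e\#e''$). The label set $\mathcal{X}$ contains a distinguished label $\varepsilon$ denoting the empty word (concatenating $\varepsilon$ does not change a word). There is a special event $\bot\in E$ with no event below it, $\bot<e$ for all other events $e$, and $h(\bot)=\varepsilon$. A configuration is a set $C\subseteq E$ that is left closed ($e\in C$, $e'<e$ imply $e'\in C$) and conflict free (no $e,e'\in C$ with $e\#e'$); it is maximal if no configuration strictly contains it. A trace of a configuration $C$ is a sequence of events in which every event of $C$ occurs exactly once and $e_i<e_j$ implies $i<j$. $T(\mathcal{E})$ is the union of the sets of traces of all maximal configurations of $\mathcal{E}$, and $\mathcal{L}(\mathcal{E})=\{h(t)\mid t\in T(\mathcal{E})\}$, where $h(t)$ is the word obtained by applying $h$ pointwise (with $\varepsilon$ contributing nothing). *)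

(* Defs.v *)
From mathcomp Require Import all_boot.
Unset Strict Implicit. Unset Printing Implicit Defensive.

(* Events are 'I_n; labels are natural numbers (the label set X is    *)
(* taken to be nat), and the distinguished label epsilon is 0.        *)

Record fles := FLES {
  nev   : nat;
  evlt  : rel 'I_nev;
  evcf  : rel 'I_nev;
  evlab : 'I_nev -> nat
}.

Arguments evlt : clear implicits.
Arguments evcf : clear implicits.
Arguments evlab : clear implicits.

Definition eps : nat := 0.

Definition is_fles (E : fles) : Prop :=
  [/\ (forall e : 'I_(nev E), ~~ evlt E e e) /\
      (forall e1 e2 e3 : 'I_(nev E), evlt E e1 e2 -> evlt E e2 e3 -> evlt E e1 e3),
      (forall e : 'I_(nev E), ~~ evcf E e e),
      (forall e1 e2 : 'I_(nev E), evcf E e1 e2 -> evcf E e2 e1),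
      (forall e e' e'' : 'I_(nev E), evcf E e e' -> evlt E e' e'' -> evcf E e e'') &
      exists bot : 'I_(nev E),
        [/\ (forall e, ~~ evlt E e bot),
            (forall e, e != bot -> evlt E bot e) &
            evlab E bot = eps]].

Definition is_config (E : fles) (C : {set 'I_(nev E)}) : Prop :=
  (forall e e', e \in C -> evlt E e' e -> e' \in C) /\
  (forall e e', e \in C -> e' \in C -> ~~ evcf E e e').

Definition is_max_config (E : fles) (C : {set 'I_(nev E)}) : Prop :=
  is_config E C /\
  (forall C', is_config E C' -> C \subset C' -> C' = C).

Definition is_trace (E : fles) (C : {set 'I_(nev E)}) (t : seq 'I_(nev E)) : Prop :=
  [/\ uniq t,
      (forall e, (e \in t) = (e \in C)) &
      (forall (x0 : 'I_(nev E)) i j, i < size t -> j < size t ->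
          evlt E (nth x0 t i) (nth x0 t j) -> i < j)].

Definition hword (E : fles) (t : seq 'I_(nev E)) : seq nat :=
  [seq evlab E e | e <- t & evlab E e != eps].

Definition in_lang (E : fles) (w : seq nat) : Prop :=
  exists (C : {set 'I_(nev E)}) (t : seq 'I_(nev E)),
    [/\ is_max_config E C, is_trace E C t & hword E t = w].

(* Computation model: deterministic single-tape Turing machines over  *)
(* the input alphabet isym, tape alphabet option isym (None = blank), *)
(* two-way infinite tape.                                             *)

Inductive isym := I0 | I1 | ISep | IHash.
Inductive move := ML | MR | MS.

Record TM := {
  tmQ : finType;
  tm_start : tmQ;
  tm_acc : tmQ;
  tm_rej : tmQ;
  tm_delta : tmQ -> option isym -> tmQ * option isym * move
}.

(* state, (reversed left part, scanned cell, right part) *)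
Definition tm_config (M : TM) :=
  (tmQ M * (seq (option isym) * option isym * seq (option isym)))%type.

Definition tm_step (M : TM) (c : tm_config M) : tm_config M :=
  let: (q, (l, a, r)) := c in
  if (q == tm_acc M) || (q == tm_rej M) then c else
  let: (q', b, m) := tm_delta M q a in
  match m with
  | MS => (q', (l, b, r))
  | ML => (q', (behead l, head None l, b :: r))
  | MR => (q', (b :: l, head None r, behead r))
  end.

Definition tm_init (M : TM) (x : seq isym) : tm_config M :=
  (tm_start M, ([::], head None (map Some x), behead (map Some x))).

Definition state_after (M : TM) (x : seq isym) (k : nat) : tmQ M :=
  (iter k (tm_step M) (tm_init M x)).1.

Definition poly (c d n : nat) : nat := c * n ^ d + c.

Definition in_NP (L : seq isym -> Prop) : Prop :=
  exists (V : TM) (c d : nat),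
    (forall z : seq isym,
        state_after V z (poly c d (size z)) = tm_acc V \/
        state_after V z (poly c d (size z)) = tm_rej V) /\
    (forall x : seq isym,
        L x <->
        exists y : seq isym,
          size y <= poly c d (size x) /\
          state_after V (x ++ IHash :: y) (poly c d (size (x ++ IHash :: y)))
            = tm_acc V).

Fixpoint bin_aux (fuel k : nat) : seq isym :=
  match fuel with
  | 0 => [::]
  | f.+1 => if k == 0 then [::] else (if odd k then I1 else I0) :: bin_aux f k./2
  end.

(* little-endian binary, no trailing zeros, terminated by ISep *)
Definition enc_nat (k : nat) : seq isym := bin_aux k k ++ [:: ISep].

Definition enc_rel {n : nat} (r : rel 'I_n) : seq isym :=
  [seq (if r i j then I1 else I0) | i <- enum 'I_n, j <- enum 'I_n].

Definition enc_fles (E : fles) : seq isym :=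
  nseq (nev E) I1 ++ ISep :: enc_rel (@evlt E) ++ ISep :: enc_rel (@evcf E)
    ++ ISep :: flatten [seq enc_nat (evlab E i) | i <- enum 'I_(nev E)].

Definition enc_inst (E : fles) (w : seq nat) : seq isym :=
  enc_fles E ++ ISep :: flatten (map enc_nat w).

Definition FLES_MEMBERSHIP (x : seq isym) : Prop :=
  exists (E : fles) (w : seq nat), x = enc_inst E w /\ is_fles E /\ in_lang E w.

(* Main.v *)
Require Import Defs.
From HB Require Import structures.
From mathcomp Require Import all_boot zify.
Set Implicit Arguments. Unset Strict Implicit. Unset Printing Implicit Defensive.

(* A sentence of first-order logic with [+] and [*], whose variables range over
   the positions of a word [z], is decided in polynomial time by a Turing
   machine: quantifiers are loops over a pointer, and each elementary operation
   on pointers is one left-to-right pass over the tape. Hence every existential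
   second-order property of a word [x] is in NP: the certificate [y] tabulates
   the relations, and the sentence is evaluated on [x # y].
   Membership in the language of an event structure is of this kind. The three
   relations guessed are the trace, the position in [x] at which each label
   starts, and the position in [x] of the letter expected after each prefix of
   the trace. Maximality of the configuration is first-order because a maximal
   configuration is one that cannot be extended by a single event: an event
   outside it has a cause outside it or a conflict inside it. *)

(** * Sweep machines and their simulation by Turing machines *)

(** The obstacle is the machine model: the tape carries only the four input symbols and the blank,
    so a pointer cannot be written beside the symbol it points to. [K] pointers mark at most [K]
    cells; these are blanked and their contents kept in the finite control, which is why [K] may
    depend on the sentence only. A pointer that leaves the word is lost, so all positions beyond the
    end are confused: arithmetic is computed up to this confusion ([eqv]), and the atoms have a
    truncated meaning that respects it. Products are needed to address tables, the entry [(i, j)] of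
    an [n] by [n] table being at offset [i * n + j]. The verifier must halt in polynomial time on
    every word, not only on those of the form [x # y]; sentences are therefore interpreted over
    arbitrary words, and [x] is recovered as what precedes the only hash. *)

Definition isym_code (a : isym) : bool * bool :=
  match a with
  | I0 => (false, false) | I1 => (false, true)
  | ISep => (true, false) | IHash => (true, true)
  end.

Definition isym_decode (b : bool * bool) : isym :=
  match b with
  | (false, false) => I0 | (false, true) => I1
  | (true, false) => ISep | (true, true) => IHash
  end.

Lemma isym_codeK : cancel isym_code isym_decode.
Proof. by case. Qed.

HB.instance Definition _ := Finite.copy isym (can_type isym_codeK).

Section SweepMachine.
Variable K : nat.

Definition letter := (isym * {set 'I_K})%type.

(* A machine works in left-to-right passes that may change the marks only; at
   the end of a pass, [sm_end] starts a new pass or halts with an answer. *)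
Record smachine := SMachine {
  smQ : finType;
  sm_start : smQ;
  sm_delta : smQ -> letter -> smQ * {set 'I_K};
  sm_end : smQ -> smQ + bool
}.

Section Runs.
Variable M : smachine.

Fixpoint sweep (q : smQ M) (s : seq letter) : smQ M * seq letter :=
  if s is l :: s1 then
    let qm := sm_delta q l in
    let qs := sweep qm.1 s1 in (qs.1, (l.1, qm.2) :: qs.2)
  else (q, [::]).

Definition marked (s : seq letter) := [seq l <- s | l.2 != set0].

Definition few_marks (s : seq letter) := size (marked s) <= K.

(** Requiring [few_marks] before and after each pass is what makes the pass simulable: the marked
    letters fit in the finite control. The number counts passes. *)
Inductive runs : smQ M -> seq letter -> nat -> bool -> seq letter -> Prop :=
| runs_halt q s b : few_marks s -> few_marks (sweep q s).2 ->
    sm_end (sweep q s).1 = inr b -> runs q s 1 b (sweep q s).2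
| runs_next q q' s k b s' : few_marks s -> few_marks (sweep q s).2 ->
    sm_end (sweep q s).1 = inl q' -> runs q' (sweep q s).2 k b s' ->
    runs q s k.+1 b s'.

Lemma size_sweep s q : size (sweep q s).2 = size s.
Proof. by elim: s q => //= l s IHs q; rewrite IHs. Qed.

Definition letters := {bseq K of letter}.

(** A right-moving state holds the marked letters not yet met and those already written; a
    left-moving one holds a countdown of the blanks still to cross and the letters for the next
    pass. A blank met when the first list is empty lies outside the word. Only the length of the
    countdown matters. *)
Definition stateQ : finType :=
  (smQ M * letters * letters + smQ M * letters * letters + bool)%type.

Definition rightQ (q : smQ M) (L L' : letters) : stateQ := inl (inl (q, L, L')).
Definition leftQ (q : smQ M) (L L' : letters) : stateQ := inl (inr (q, L, L')).
Definition haltQ (b : bool) : stateQ := inr b.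

Definition encl (l : letter) : option isym :=
  if l.2 == set0 then Some l.1 else None.

(* A marked letter is blank on the tape of the Turing machine. The blanks met
   during a pass are identified by their rank: the letters they stand for are
   kept, in order, in the finite control. *)
Definition tm_delta_of (st : stateQ) (c : option isym) :
    stateQ * option isym * move :=
  match st with
  | inl (inl (q, L, L')) =>
    let go := fun (l : letter) (L1 : seq letter) =>
      let qm := sm_delta q l in
      let l' := (l.1, qm.2) in
      (rightQ qm.1 (insub_bseq K L1)
         (if l'.2 == set0 then L' else insub_bseq K (rcons L' l')),
       encl l', MR) in
    match c, (L : seq letter) with
    | Some a, L1 => go (a, set0) L1
    | None, l :: L1 => go l L1
    | None, [::] =>
      match sm_end q with
      | inl q' => (leftQ q' (insub_bseq K (rev L')) L', None, ML)
      | inr b => (haltQ b, None, MS)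
      end
    end
  | inl (inr (q, C, L)) =>
    match c, (C : seq letter) with
    | Some a, _ => (st, c, ML)
    | None, _ :: C1 => (leftQ q (insub_bseq K C1) L, None, ML)
    | None, [::] => (rightQ q L (insub_bseq K [::]), None, MR)
    end
  | inr b => (haltQ b, c, MS)
  end.

Definition tm_of : TM :=
  {| tmQ := stateQ;
     tm_start := rightQ (sm_start M) (insub_bseq K [::]) (insub_bseq K [::]);
     tm_acc := haltQ true;
     tm_rej := haltQ false;
     tm_delta := tm_delta_of |}.

(** The tape is cut between [l], reversed, and [u]; the head stands just after the cut when moving
    right and just before it when moving left. *)
Definition at_right (l u : seq (option isym)) := (l, head None u, behead u).
Definition at_left (l u : seq (option isym)) := (behead l, head None l, u).

Lemma insub_bseqK (s : seq letter) : size s <= K -> insub_bseq K s = s :> seq _.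
Proof. by move=> h; rewrite /insub_bseq /insubd insubT. Qed.

Lemma step_rightQ q L L' c l u :
  tm_step tm_of (rightQ q L L', at_right l (c :: u)) =
  let: (q', b, m) := tm_delta_of (rightQ q L L') c in
  match m with
  | MS => (q', (l, b, u))
  | ML => (q', (behead l, head None l, b :: u))
  | MR => (q', (b :: l, head None u, behead u))
  end.
Proof. by []. Qed.

(** Induction with accumulator [L']. Bounding [L'] together with the letters still to be written
    keeps every list within length [K], where [insub_bseq] is the identity. *)
Lemma right_pass s q (L' : seq letter) l u :
  few_marks s -> size L' + size (marked (sweep q s).2) <= K ->
  iter (size s) (tm_step tm_of)
    (rightQ q (insub_bseq K (marked s)) (insub_bseq K L'),
     at_right l (map encl s ++ u)) =
  (rightQ (sweep q s).1 (insub_bseq K [::])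
     (insub_bseq K (L' ++ marked (sweep q s).2)),
   at_right (catrev (map encl (sweep q s).2) l) u).
Proof.
elim: s q L' l => [|x s IHs] q L' l; first by rewrite /= cats0.
move=> fm hK; rewrite [size _]/= iterSr map_cons cat_cons.
have hsz : size L' <= K by lia.
have fms : few_marks s.
  by move: fm; rewrite /few_marks /marked /=; case: ifP => //= _ /ltnW.
have -> : tm_step tm_of
    (rightQ q (insub_bseq K (marked (x :: s))) (insub_bseq K L'),
     at_right l (encl x :: map encl s ++ u)) =
   (rightQ (sm_delta q x).1 (insub_bseq K (marked s))
      (insub_bseq K (L' ++ marked [:: (x.1, (sm_delta q x).2)])),
    at_right (encl (x.1, (sm_delta q x).2) :: l) (map encl s ++ u)).
  rewrite step_rightQ /=.
  have hL : (if (sm_delta q x).2 == set0 then insub_bseq K L'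
     else insub_bseq K (rcons (insub_bseq K L') (x.1, (sm_delta q x).2))) =
     insub_bseq K (L' ++ marked [:: (x.1, (sm_delta q x).2)]).
    rewrite /marked /=; case: eqP => _ /=; first by rewrite cats0.
    by rewrite cats1 insub_bseqK.
  have {}fm : size (if x.2 != set0 then x :: marked s else marked s) <= K by [].
  rewrite {1}/encl; case: x hL fm {hK} => a m /=.
  case: (m =P set0) => [-> | /eqP hm] /= hL fm; first by rewrite insub_bseqK // hL.
  by rewrite (insub_bseqK (s := _ :: _)) //= hL.
rewrite IHs //.
  rewrite -catA /marked /=; case: ifP => //=.
move: hK; rewrite size_cat /marked /=; case: ifP => //=; lia.
Qed.

Lemma left_pass s q L v u : few_marks s ->
  iter (size s) (tm_step tm_of)
    (leftQ q (insub_bseq K (marked s)) L, at_left (map encl s ++ v) u) =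
  (leftQ q (insub_bseq K [::]) L, at_left v (catrev (map encl s) u)).
Proof.
elim: s u => [//|x s IHs] u fm; rewrite [size _]/= iterSr /=.
have fms : few_marks s.
  by move: fm; rewrite /few_marks /marked /=; case: ifP => //= _ /ltnW.
rewrite -IHs //; congr (iter _ _ _).
have {}fm : size (if x.2 != set0 then x :: marked s else marked s) <= K by [].
case: x fm => a m /=; rewrite /tm_step /= /encl /=.
case: (m =P set0) => [->|/eqP hm] /= fm //; rewrite insub_bseqK //.
Qed.

Lemma marked_rev s : marked (rev s) = rev (marked s).
Proof. by rewrite /marked filter_rev. Qed.

Lemma behead_nseq T n (x : T) : behead (nseq n x) = nseq n.-1 x.
Proof. by case: n. Qed.

Lemma head_nseq T n (x : T) : head x (nseq n x) = x.
Proof. by case: n. Qed.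

(** [i] and [j] count explicit blanks around the word: turning at an end materialises a blank cell,
    so the form of the configuration is restored only up to these numbers. *)
Definition sweep_start q s i j : tm_config tm_of :=
  (rightQ q (insub_bseq K (marked s)) (insub_bseq K [::]),
   at_right (nseq i None) (map encl s ++ nseq j None)).

Lemma step_end q (L' : letters) l j :
  tm_step tm_of (rightQ q (insub_bseq K [::]) L', at_right l (nseq j None)) =
  match sm_end q with
  | inl q' => (leftQ q' (insub_bseq K (rev L')) L', at_left l (nseq j.-1.+1 None))
  | inr b => (haltQ b, at_right l (nseq j.-1.+1 None))
  end.
Proof.
rewrite /tm_step /at_right head_nseq behead_nseq /= insub_bseqK //=.
by case: (sm_end q) => // b; rewrite head_nseq.
Qed.

Lemma sweep_halt q s i j b : few_marks s -> few_marks (sweep q s).2 ->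
  sm_end (sweep q s).1 = inr b ->
  (iter (size s).+1 (tm_step tm_of) (sweep_start q s i j)).1 = haltQ b.
Proof.
move=> fm fm' hq; rewrite iterS right_pass //. by rewrite (step_end (sweep q s).1) hq.

Qed.

Lemma sweep_next q s i j q' : few_marks s -> few_marks (sweep q s).2 ->
  sm_end (sweep q s).1 = inl q' ->
  exists i' j', iter (2 * size s + 2) (tm_step tm_of) (sweep_start q s i j) =
  sweep_start q' (sweep q s).2 i' j'.
Proof.
move=> fm fm' hq; exists i.-1.+1, j.-1.+1.
(* [size s] steps right, one to turn, [size s] steps left, one to turn. *)
rewrite (_ : 2 * size s + 2 = 1 + (size s + (1 + size s))); last lia.
rewrite !iterD right_pass //.
rewrite -![iter 1 _ _]/(tm_step _ _) (step_end (sweep q s).1) hq cat0s.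
rewrite insub_bseqK // -marked_rev -[size s](size_sweep _ q) -size_rev.
rewrite catrevE -map_rev left_pass; last by rewrite /few_marks marked_rev size_rev.
rewrite catrevE -map_rev revK /tm_step /at_left head_nseq behead_nseq /=.
by rewrite insub_bseqK.
Qed.

Lemma runs_sim q s k b s' i j : runs q s k b s' ->
  exists2 t, t <= k * (2 * size s + 2) &
    (iter t (tm_step tm_of) (sweep_start q s i j)).1 = haltQ b.
Proof.
move=> h; elim: h i j => {q s k b s'} [q s b fm fm' hq | q q' s k b s' fm fm' hq _ IH] i j.
  by exists (size s).+1; [lia | apply: sweep_halt].
have [i' [j' hs]] := sweep_next i j fm fm' hq.
have [t ht ht'] := IH i' j'.
exists (t + (2 * size s + 2)); first by rewrite size_sweep in ht; lia.
by rewrite iterD hs.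
Qed.

Lemma iter_halted t c b : c.1 = haltQ b ->
  (iter t (tm_step tm_of) c).1 = haltQ b.
Proof.
move=> hc; elim: t => //= t IH; move: IH.
case: (iter t _ c) => [q [[l a] r]] /= ->.
by case: b {hc}; rewrite eqxx //= orbT.
Qed.

Lemma state_after_runs (x : seq isym) k b s' t :
  runs (sm_start M) [seq (a, set0) | a <- x] k b s' ->
  k * (2 * size x + 2) <= t -> state_after tm_of x t = haltQ b.
Proof.
move=> h ht; have [u hu hu'] := runs_sim 0 0 h; rewrite size_map in hu.
rewrite /state_after -(subnK (leq_trans hu ht)) iterD; apply: iter_halted.
rewrite -{}hu'; congr (iter _ _ _).1.
rewrite /tm_init /sweep_start /tm_of /=; congr (rightQ _ _ _, _).
  congr insub_bseq; rewrite /marked; elim: x {h ht hu} => //= a x IH.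
  by rewrite eqxx.
rewrite /at_right -map_comp cats0.
by congr (_, head _ _, behead _); apply: eq_map => a; rewrite /= /encl /= eqxx.
Qed.

End Runs.
End SweepMachine.

(** * Computing on pointers *)

Definition env := nat -> nat.

Definition upd (e : env) (p v : nat) : env := fun q => if q == p then v else e q.

Section Computable.
Variable K : nat.
Implicit Types (z : seq isym) (e : env) (M : smachine K).

(* Pointer [p] marks cell [e p]; a value [e p >= size z] leaves no trace on the
   tape, so all such values are indistinguishable to the machine. *)
Definition cell z e (i : nat) : letter K :=
  (nth I0 z i, [set p : 'I_K | e p == i]).

Definition tape z e : seq (letter K) := [seq cell z e i | i <- iota 0 (size z)].

(** The position of a marked cell is the value of some pointer, and there are [K] pointers. *)
Lemma few_marks_tape z e : few_marks (tape z e).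
Proof.
rewrite /few_marks /marked /tape filter_map size_map.
set s := filter _ _; rewrite -[X in _ <= X]card_ord cardE -(size_map (e \o val)).
apply: uniq_leq_size => [|i]; first by rewrite filter_uniq ?iota_uniq.
rewrite mem_filter => /andP[/set0Pn[p]]; rewrite inE => /eqP <- _.
by apply/mapP; exists p; rewrite ?mem_enum.
Qed.

Definition sm_runs M z e k b e' :=
  runs (sm_start M) (tape z e) k b (tape z e').

(* Relational postconditions: each run of the machine realises one of the
   outcomes allowed by [R], in a number of passes polynomial in [size z]. *)
Definition computes (R : seq isym -> env -> bool -> env -> Prop) :=
  exists M c d, forall z e, exists k b e',
    [/\ k <= c * (size z).+1 ^ d, sm_runs M z e k b e' & R z e b e'].

Lemma comp_weaken (R R' : seq isym -> env -> bool -> env -> Prop) :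
  computes R -> (forall z e b e', R z e b e' -> R' z e b e') -> computes R'.
Proof.
move=> [M [c [d h]]] hR; exists M, c, d => z e.
by have [k [b [e' [? ? /hR ?]]]] := h z e; exists k, b, e'.
Qed.

(** * Composition of machines: a run as a phase of a larger machine *)

Section Embedding.
Variables (M M' : smachine K) (phi : smQ M -> smQ M').
Hypothesis phi_delta : forall q l,
  sm_delta (phi q) l = (phi (sm_delta q l).1, (sm_delta q l).2).
Hypothesis phi_end : forall q q', sm_end q = inl q' -> sm_end (phi q) = inl (phi q').

Lemma sweep_embed q s : sweep (phi q) s = (phi (sweep q s).1, (sweep q s).2).
Proof. by elim: s q => //= l s IHs q; rewrite phi_delta IHs. Qed.

Lemma runs_embed_next b q s k s1 r k' b' s2 :
  (forall q, sm_end q = inr b -> sm_end (phi q) = inl r) ->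
  runs q s k b s1 -> runs r s1 k' b' s2 -> runs (phi q) s (k + k') b' s2.
Proof.
move=> hb h; elim: h hb => {q s k b s1} [q s b fm fm' hq | q q' s k b s1 fm fm' hq _ IH] hb h'.
  by apply: (@runs_next _ _ _ r); rewrite ?sweep_embed //; apply: hb.
rewrite addSn; apply: (@runs_next _ _ _ (phi q')); rewrite ?sweep_embed //=.
  exact: phi_end.
exact: IH.
Qed.

Lemma runs_embed_halt b q s k s1 b' :
  (forall q, sm_end q = inr b -> sm_end (phi q) = inr b') ->
  runs q s k b s1 -> runs (phi q) s k b' s1.
Proof.
move=> hb h; elim: h hb => {q s k b s1} [q s b fm fm' hq | q q' s k b s1 fm fm' hq _ IH] hb.
  have -> : (sweep q s).2 = (sweep (phi q) s).2 by rewrite sweep_embed.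
  by apply: runs_halt; rewrite ?sweep_embed //; apply: hb.
apply: (@runs_next _ _ _ (phi q')); rewrite ?sweep_embed //=.
  exact: phi_end.
exact: IH.
Qed.

End Embedding.

Definition sm_ite M1 M2 M3 : smachine K :=
  @SMachine K (smQ M1 + smQ M2 + smQ M3)%type
    (inl (inl (sm_start M1)))
    (fun q l => match q with
     | inl (inl q) => (inl (inl (sm_delta q l).1), (sm_delta q l).2)
     | inl (inr q) => (inl (inr (sm_delta q l).1), (sm_delta q l).2)
     | inr q => (inr (sm_delta q l).1, (sm_delta q l).2)
     end)
    (fun q => match q with
     | inl (inl q) => match sm_end q with
       | inl q' => inl (inl (inl q'))
       | inr true => inl (inl (inr (sm_start M2)))
       | inr false => inl (inr (sm_start M3))
       end
     | inl (inr q) => match sm_end q with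
       | inl q' => inl (inl (inr q')) | inr b => inr b end
     | inr q => match sm_end q with
       | inl q' => inl (inr q') | inr b => inr b end
     end).

(** With the positive base [n.+1] a bound can only grow with its exponent, so bounds of this shape
    absorb sums. *)
Lemma cost_le n c1 d1 c2 d2 :
  c1 * n.+1 ^ d1 + c2 * n.+1 ^ d2 <= (c1 + c2) * n.+1 ^ (d1 + d2).
Proof.
by rewrite mulnDl; apply: leq_add; apply: leq_mul => //; apply: leq_pexp2l; lia.
Qed.

Lemma comp_ite (F G H R : seq isym -> env -> bool -> env -> Prop) :
  computes F -> computes G -> computes H ->
  (forall z e b1 e1 b e2, F z e b1 e1 ->
     (if b1 then G z e1 b e2 else H z e1 b e2) -> R z e b e2) ->
  computes R.
Proof.
move=> [M1 [c1 [d1 h1]]] [M2 [c2 [d2 h2]]] [M3 [c3 [d3 h3]]] hR.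
exists (sm_ite M1 M2 M3), (c1 + (c2 + c3)), (d1 + (d2 + d3)) => z e.
have [k1 [b1 [e1 [hk1 r1 f1]]]] := h1 z e.
have le1 := cost_le (size z) c1 d1 (c2 + c3) (d2 + d3).
have le2 := cost_le (size z) c2 d2 c3 d3.
case: b1 r1 f1 => r1 f1.
  have [k2 [b2 [e2 [hk2 r2 f2]]]] := h2 z e1.
  exists (k1 + k2), b2, e2; split; [lia | | exact: hR f1 f2].
  apply: (@runs_embed_next M1 (sm_ite M1 M2 M3) (inl \o inl)) r1 _ => //.
  - by move=> q q' /= ->.
  - by move=> q /= ->.
  apply: (@runs_embed_halt M2 (sm_ite M1 M2 M3) (inl \o inr)) r2 => //.
  - by move=> q q' /= ->.
  - by move=> q /= ->.
have [k2 [b2 [e2 [hk2 r2 f2]]]] := h3 z e1.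
exists (k1 + k2), b2, e2; split; [lia | | exact: hR f1 f2].
apply: (@runs_embed_next M1 (sm_ite M1 M2 M3) (inl \o inl)) r1 _ => //.
- by move=> q q' /= ->.
- by move=> q /= ->.
apply: (@runs_embed_halt M3 (sm_ite M1 M2 M3) inr) r2 => //.
- by move=> q q' /= ->.
- by move=> q /= ->.
Qed.

Definition sm_loop M : smachine K :=
  @SMachine K (smQ M) (sm_start M) (@sm_delta K M)
    (fun q => match sm_end q with
     | inl q' => inl q'
     | inr true => inl (sm_start M)
     | inr false => inr true
     end).

(** The loop has no counter of its own; the invariant bounds its length. An iteration that answers
    [true] forces [i < size z], so there are at most [(size z).+1] iterations, which costs one more
    degree. *)
Lemma comp_loop (B R : seq isym -> env -> bool -> env -> Prop)
    (P : seq isym -> env -> nat -> env -> Prop) :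
  computes B ->
  (forall z e, P z e 0 e) ->
  (forall z e i e1 b e2, P z e i e1 -> B z e1 b e2 ->
     if b then i < size z /\ P z e i.+1 e2 else R z e true e2) ->
  computes R.
Proof.
move=> [M [c [d h]]] hP0 hP; exists (sm_loop M), c, d.+1 => z e.
suff loop j : forall i e1, i + j = size z -> P z e i e1 -> exists k e2,
    [/\ k <= j.+1 * (c * (size z).+1 ^ d), sm_runs (sm_loop M) z e1 k true e2 &
        R z e true e2].
  have [k [e2 [hk hr hR]]] := loop (size z) 0 e (add0n _) (hP0 z e).
  by exists k, true, e2; split; rewrite // expnS mulnCA.
have phi_end : forall q q' : smQ M, sm_end q = inl q' ->
    @sm_end K (sm_loop M) q = inl q' by move=> q q' /= ->.
have phi_delta : forall (q : smQ M) l,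
    @sm_delta K (sm_loop M) q l = ((sm_delta q l).1, (sm_delta q l).2).
  by move=> q l; rewrite /= -surjective_pairing.
elim: j => [|j IHj] i e1 hij hPi; have [k [b [e2 [hk r f]]]] := h z e1;
  have := hP _ _ _ _ _ _ hPi f; case: b r {f} => r.
- by case; lia.
- move=> hR; exists k, e2; split=> //; first by rewrite mul1n.
  by apply: (@runs_embed_halt M (sm_loop M) id phi_delta phi_end _ _ _ _ _ _ _ r) => q /= ->.
- case=> _ hPi'; have hij' : i.+1 + j = size z by lia.
  have [k' [e3 [hk' r' hR]]] := IHj _ _ hij' hPi'.
  exists (k + k'), e3; split=> //; first by rewrite mulSn; lia.
  by apply: (@runs_embed_next M (sm_loop M) id phi_delta phi_end _ _ _ _ _ _ _ _ _ _ r) r' => q /= ->.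
- move=> hR; exists k, e2; split=> //.
    by rewrite mulSn; apply: leq_trans hk (leq_addr _ _).
  by apply: (@runs_embed_halt M (sm_loop M) id phi_delta phi_end _ _ _ _ _ _ _ r) => q /= ->.
Qed.

Definition sm_test (f : letter K -> bool) : smachine K :=
  @SMachine K bool false (fun b l => (b || f l, l.2)) (fun b => inr b).

Lemma sweep_test f (b : smQ (sm_test f)) s : sweep b s = (b || has f s, s).
Proof.
elim: s b => [|l s IHs] b /=; first by rewrite orbF.
by rewrite IHs /= orbA -surjective_pairing.
Qed.

Lemma comp_test f :
  computes (fun z e b e' => b = has f (tape z e) /\ e' = e).
Proof.
exists (sm_test f), 1, 0 => z e; exists 1, (has f (tape z e)), e; split=> //.
have := @runs_halt K (sm_test f) false (tape z e) (has f (tape z e)).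
by rewrite sweep_test; apply; rewrite ?few_marks_tape.
Qed.

Lemma comp_ret b0 : computes (fun z e b e' => b = b0 /\ e' = e).
Proof.
have htest := comp_test pred0.
case: b0; last first.
  by apply: comp_weaken htest _ => z e b e' [-> ->]; rewrite has_pred0.
(* A loop answers [true] as soon as its body answers [false]; looping on a test that never succeeds
   gives the constant [true]. *)
have hloop : computes (fun z e b e' => b = true /\ e' = e).
  apply: (comp_loop (P := fun z e i e1 => e1 = e) htest) => // z e i e1 b e2 -> [-> ->].
  by rewrite has_pred0.
exact: hloop.
Qed.

(** * Moving one pointer in one pass *)

Section Update.
Variables (p : 'I_K) (g : letter K -> bool) (h : bool -> letter K -> bool) (s0 : bool).

Definition sm_upd : smachine K :=
  @SMachine K bool s0 (fun b l => (g l, if h b l then p |: l.2 else l.2 :\ p))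
    (fun _ => inr true).

(** The control remembers one bit of the preceding cell, [s0] standing before the first one; this
    suffices to reset, copy or shift a mark. Nothing is asked outside the word, so the new value may
    leave it. *)
Lemma comp_upd (v : seq isym -> env -> nat) :
  (forall z e i, i < size z ->
     h (if i is j.+1 then g (cell z e j) else s0) (cell z e i) = (v z e == i)) ->
  computes (fun z e b e' => b = true /\ e' = upd e p (v z e)).
Proof.
move=> hv; exists sm_upd, 1, 0 => z e; exists 1, true, (upd e p (v z e)); split=> //.
pose st i : smQ sm_upd := if i is j.+1 then g (cell z e j) else s0.
have sw n k : k + n <= size z -> sweep (st k) [seq cell z e i | i <- iota k n] =
    (st (k + n), [seq cell z (upd e p (v z e)) i | i <- iota k n]).
  elim: n k => [|n IHn] k hk /=; first by rewrite addn0.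
  have -> : g (cell z e k) = st k.+1 by [].
  rewrite IHn ?addSnnS //=; congr (_, (_, _) :: _).
  rewrite hv; last lia.
  apply/setP => q; rewrite /upd; case: (v z e =P k) => [hk' | /eqP hk'];
  rewrite !inE -val_eqE /=; case: eqP => //= _; first by rewrite hk' eqxx.
  by rewrite (negbTE hk').
have {}sw := sw _ _ (leqnn (0 + size z)).
have sw2 : tape z (upd e p (v z e)) = (sweep (sm_start sm_upd) (tape z e)).2.
  by rewrite /tape -[sm_start _]/(st 0) sw.
rewrite /sm_runs sw2; apply: runs_halt; rewrite -?sw2 ?few_marks_tape //.
Qed.

End Update.

Lemma comp_zero (p : 'I_K) :
  computes (fun z e b e' => b = true /\ e' = upd e p 0).
Proof.
apply: (@comp_upd p xpred0 (fun s _ => s) true (fun _ _ => 0)).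
by move=> z e [].
Qed.

Lemma comp_copy (p q : 'I_K) :
  computes (fun z e b e' => b = true /\ e' = upd e p (e q)).
Proof.
apply: (@comp_upd p xpred0 (fun _ l => q \in l.2) true (fun _ e => e q)).
by move=> z e i _; rewrite inE.
Qed.

Lemma comp_inc (p : 'I_K) :
  computes (fun z e b e' => b = true /\ e' = upd e p (e p).+1).
Proof.
apply: (@comp_upd p (fun l => p \in l.2) (fun s _ => s) false (fun _ e => (e p).+1)).
by move=> z e [|i] _ //; rewrite inE eqSS.
Qed.

Lemma comp_set (p : 'I_K) :
  computes (fun z e b e' => b = (e p < size z) /\ e' = e).
Proof.
apply: comp_weaken (comp_test (fun l => p \in l.2)) _ => z e b e' [-> ->].
split=> //; apply/hasP/idP => [[_ /mapP[i hi ->]] | hp].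
  by rewrite inE => /eqP ->; move: hi; rewrite mem_iota.
by exists (cell z e (e p)); [apply: map_f; rewrite mem_iota | rewrite inE].
Qed.

Lemma comp_sym (a : isym) (p : 'I_K) :
  computes (fun z e b e' =>
    b = (e p < size z) && (nth I0 z (e p) == a) /\ e' = e).
Proof.
apply: comp_weaken (comp_test (fun l => (p \in l.2) && (l.1 == a))) _ => z e b e' [-> ->].
split=> //; apply/hasP/andP => [[_ /mapP[i hi ->]] | [hp ha]].
  rewrite inE => /andP[/eqP -> ->]; move: hi; rewrite mem_iota.
  by case/andP.
exists (cell z e (e p)); [by apply: map_f; rewrite mem_iota | by rewrite inE eqxx].
Qed.

Lemma comp_eq (p q : 'I_K) :
  computes (fun z e b e' => b = (e p < size z) && (e p == e q) /\ e' = e).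
Proof.
apply: comp_weaken (comp_test (fun l => (p \in l.2) && (q \in l.2))) _ => z e b e' [-> ->].
split=> //; apply/hasP/andP => [[_ /mapP[i hi ->]] | [hp /eqP hpq]].
  rewrite !inE => /andP[/eqP -> /eqP ->]; move: hi; rewrite mem_iota eqxx.
  by case/andP.
exists (cell z e (e p)); first by apply: map_f; rewrite mem_iota.
by rewrite !inE hpq eqxx.
Qed.

End Computable.

(** * First-order logic over the positions of a word *)

Inductive term :=
| tVar of nat | tZero | tSucc of term | tAdd of term & term | tMul of term & term.

Fixpoint ev (e : env) (t : term) : nat :=
  match t with
  | tVar p => e p
  | tZero => 0
  | tSucc t => (ev e t).+1
  | tAdd t u => ev e t + ev e u
  | tMul t u => ev e t * ev e u
  end.

Fixpoint term_wf m (t : term) : bool :=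
  match t with
  | tVar p => p < m
  | tZero => true
  | tSucc t => term_wf m t
  | tAdd t u | tMul t u => term_wf m t && term_wf m u
  end.

(* Number of scratch pointers used to evaluate a term. *)
Fixpoint term_cost (t : term) : nat :=
  match t with
  | tVar _ | tZero => 1
  | tSucc t => term_cost t
  | tAdd t u | tMul t u => maxn 5 (maxn (term_cost t) (term_cost u).+1)
  end.

Lemma term_cost_gt0 t : 0 < term_cost t.
Proof. by elim: t => //= *; lia. Qed.

Inductive form :=
| fSym of isym & term
| fEq of term & term
| fLt of term & term
| fNot of form
| fAnd of form & form
| fOr of form & form
| fImp of form & form
| fEx of form
| fAll of form.

(* The variables are de Bruijn levels: a quantifier below [m] others binds
   variable [m]. An atom is false when its value points outside [z]: a machine
   that works on the cells of [z] cannot tell such values apart. *)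
Fixpoint sem m (f : form) (z : seq isym) (e : env) : Prop :=
  match f with
  | fSym a t => ev e t < size z /\ nth I0 z (ev e t) = a
  | fEq t u => ev e t < size z /\ ev e t = ev e u
  | fLt t u => ev e t < ev e u /\ ev e u < size z
  | fNot f => ~ sem m f z e
  | fAnd f g => sem m f z e /\ sem m g z e
  | fOr f g => sem m f z e \/ sem m g z e
  | fImp f g => sem m f z e -> sem m g z e
  | fEx f => exists2 v, v < size z & sem m.+1 f z (upd e m v)
  | fAll f => forall v, v < size z -> sem m.+1 f z (upd e m v)
  end.

Fixpoint form_wf m (f : form) : bool :=
  match f with
  | fSym _ t => term_wf m t
  | fEq t u | fLt t u => term_wf m t && term_wf m u
  | fNot f => form_wf m f
  | fAnd f g | fOr f g | fImp f g => form_wf m f && form_wf m g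
  | fEx f | fAll f => form_wf m.+1 f
  end.

(* [fLt t u] is evaluated as [exists v, (t + v).+1 = u]. *)
Fixpoint form_cost (f : form) : nat :=
  match f with
  | fSym _ t => term_cost t
  | fEq t u => maxn (term_cost t) (term_cost u).+1
  | fLt t u => (maxn (term_cost (tSucc (tAdd t (tVar 0)))) (term_cost u).+1).+1
  | fNot f => form_cost f
  | fAnd f g | fOr f g | fImp f g => maxn (form_cost f) (form_cost g)
  | fEx f | fAll f => (form_cost f).+1
  end.

(** Pointers below [m] hold the variables in scope; those from [m] on are scratch and may be
    overwritten. *)
Definition agree m (e e' : env) := forall p, p < m -> e' p = e p.

Lemma agree_trans m e1 e2 e3 : agree m e1 e2 -> agree m e2 e3 -> agree m e1 e3.
Proof. by move=> h h' p hp; rewrite h' ?h. Qed.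

Lemma agree_leq m n e e' : m <= n -> agree n e e' -> agree m e e'.
Proof. by move=> hmn h p hp; apply: h; apply: leq_trans hmn. Qed.

Lemma agree_upd m p v e : m <= p -> agree m e (upd e p v).
Proof. by move=> hmp q hq; rewrite /upd; case: eqP => //; lia. Qed.

Lemma term_wfW m t : term_wf m t -> term_wf m.+1 t.
Proof.
elim: t => //= [p|t IHt u IHu|t IHt u IHu]; first exact: ltnW.
- by move=> /andP[/IHt -> /IHu ->].
- by move=> /andP[/IHt -> /IHu ->].
Qed.

Lemma ev_agree m t e e' : term_wf m t -> agree m e e' -> ev e' t = ev e t.
Proof.
move=> wf h; elim: t wf => //=.
- by move=> t IHt /IHt ->.
- by move=> t IHt u IHu /andP[/IHt -> /IHu ->].
- by move=> t IHt u IHu /andP[/IHt -> /IHu ->].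
Qed.

Lemma sem_agree m f z e e' : form_wf m f -> agree m e e' ->
  sem m f z e' <-> sem m f z e.
Proof.
elim: f m e e' => /=.
- by move=> a t m e e' wf /(ev_agree wf) ->.
- by move=> t u m e e' /andP[wt wu] h; rewrite !(ev_agree _ h).
- by move=> t u m e e' /andP[wt wu] h; rewrite !(ev_agree _ h).
- by move=> f IHf m e e' wf h; have := IHf _ _ _ wf h; tauto.
- move=> f IHf g IHg m e e' /andP[wf wg] h.
  by have := IHf _ _ _ wf h; have := IHg _ _ _ wg h; tauto.
- move=> f IHf g IHg m e e' /andP[wf wg] h.
  by have := IHf _ _ _ wf h; have := IHg _ _ _ wg h; tauto.
- move=> f IHf g IHg m e e' /andP[wf wg] h.
  by have := IHf _ _ _ wf h; have := IHg _ _ _ wg h; tauto.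
- move=> f IHf m e e' wf h.
  have hv v : agree m.+1 (upd e m v) (upd e' m v).
    by move=> p hp; rewrite /upd; case: eqP => // ?; apply: h; lia.
  by split=> -[v hvz hf]; exists v => //; apply/(IHf _ _ _ wf (hv v)).
- move=> f IHf m e e' wf h.
  have hv v : agree m.+1 (upd e m v) (upd e' m v).
    by move=> p hp; rewrite /upd; case: eqP => // ?; apply: h; lia.
  by split=> hf v hvz; apply/(IHf _ _ _ wf (hv v)); apply: hf.
Qed.

(** * Compilation of sentences into machines *)

Section Compile.
Variable K : nat.
Local Notation computes := (@computes K).

(** Equality as far as the tape can tell. *)
Definition eqv (z : seq isym) (a b : nat) :=
  a = b \/ size z <= a /\ size z <= b.

Lemma eqv_add z a a' b b' : eqv z a a' -> eqv z b b' -> eqv z (a + b) (a' + b').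
Proof. rewrite /eqv; lia. Qed.

(** A zero factor is the one obstacle to a product staying beyond the word. It is then the same on
    both sides, unless the word is empty and all values are identified. *)
Lemma eqv_mul z a a' b b' : eqv z a a' -> eqv z b b' -> eqv z (a * b) (a' * b').
Proof.
rewrite /eqv => -[->|[ha ha']] [->|[hb hb']]; first by left.
- case: (posnP a') => [->|h]; first by left; rewrite !mul0n.
  by right; split; nia.
- case: (posnP b') => [->|h]; first by left; rewrite !muln0.
  by right; split; nia.
by case: (posnP (size z)) => h; right; split; nia.
Qed.

Lemma eqv_trans z a b c : eqv z a b -> eqv z b c -> eqv z a c.
Proof. rewrite /eqv; lia. Qed.

Lemma comp_seq (F G R : seq isym -> env -> bool -> env -> Prop) :
  computes F -> computes G ->
  (forall z e b1 e1 b e2, F z e b1 e1 -> G z e1 b e2 -> R z e b e2) -> computes R.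
Proof.
move=> hF hG hR; apply: (comp_ite hF hG hG) => z e b1 e1 b e2 f g.
by apply: hR f _; case: b1 g.
Qed.

(** A bound [b] beyond the word can never be met by the counter, so the loop also stops when [c]
    leaves the word; hence the disjunction in the exit condition. *)
Lemma comp_for (c b : 'I_K) (B R : seq isym -> env -> bool -> env -> Prop)
    (P : seq isym -> env -> nat -> env -> Prop) :
  computes B ->
  (forall z (e : env) b' (e' : env), B z e b' e' -> e' c = e c) ->
  (forall z e, P z e 0 (upd e c 0)) ->
  (forall z e i (e1 : env) b' e2, e1 c = i -> i < size z -> P z e i e1 -> i <> e1 b ->
     B z e1 b' e2 -> P z e i.+1 (upd e2 c i.+1)) ->
  (forall z e i (e1 : env), e1 c = i -> P z e i e1 -> i = e1 b \/ size z <= i ->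
     R z e true e1) ->
  computes R.
Proof.
move=> hB hBc hP0 hP hR.
have hA : computes (fun z e b' e2 => b' = true /\
    exists b1 e1, B z e b1 e1 /\ e2 = upd e1 c (e1 c).+1).
  apply: comp_seq hB (comp_inc c) _ => z e b1 e1 b2 e2 h [-> ->].
  by split=> //; exists b1, e1.
have hA2 : computes (fun z e b' e2 => if b' then e c < size z /\
    exists b1 e1, B z e b1 e1 /\ e2 = upd e1 c (e1 c).+1 else size z <= e c /\ e2 = e).
  apply: comp_ite (comp_set c) hA (comp_ret K false) _ => z e b1 e1 b2 e2 [-> ->].
  by case: ltnP => h; case=> ->.
have hQ : computes (fun z e b' e2 => if b' then [/\ e c < size z, e c <> e b &
    exists b1 e1, B z e b1 e1 /\ e2 = upd e1 c (e1 c).+1]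
    else (e c = e b \/ size z <= e c) /\ e2 = e).
  apply: comp_ite (comp_eq c b) (comp_ret K false) hA2 _ => z e b1 e1 b2 e2 [-> ->].
  case: andP => [[h1 /eqP h2] [-> ->]|]; first by split=> //; left.
  case: b2 => h [h1 h2]; last by split=> //; right.
  by split=> // h3; apply: h; split=> //; apply/eqP.
(* The loop sees only the environment left by the reset of [c]; [e0] ranges over the environments
   that it may come from. *)
apply: (comp_seq (comp_zero c)
  (G := fun z e b' e' => b' = true /\ forall e0, e = upd e0 c 0 -> R z e0 true e')); last first.
  by move=> z e b1 e1 b2 e2 [_ he] [-> ]; apply.
apply: (comp_loop (P := fun z e i e1 => e1 c = e c + i /\
    forall e0, e = upd e0 c 0 -> P z e0 i e1) hQ).
  by move=> z e; split=> [|e0 ->]; rewrite ?addn0.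
have upd0 (e e0 : env) : e = upd e0 c 0 -> e c = 0 by move=> ->; rewrite /upd eqxx.
move=> z e i e1 [] e2 [hi h].
  move=> [h1 h2 [b1 [e' [hB' ->]]]]; split; first lia.
  rewrite /upd eqxx (hBc _ _ _ _ hB') addnS hi; split=> // e0 he.
  have hc := upd0 _ _ he; rewrite hi hc add0n in h1 h2 *.
  by apply: hP (h _ he) h2 hB' => //; rewrite hi hc.
move=> [h1 ->]; split=> // e0 he; have hc := upd0 _ _ he.
by apply: hR (h _ he) _; rewrite hi hc // in h1 *.
Qed.

(** [r] is incremented [e a] times. If the count is cut short at the end of the word, both the value
    reached and the true sum are at least [size z]. *)
Lemma comp_addto (r a c : 'I_K) : r != a -> r != c -> a != c ->
  computes (fun z e _ e' => eqv z (e' r) (e r + e a) /\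
     forall q : nat, q != r -> q != c -> e' q = e q).
Proof.
move=> hra hrc hac.
have nra : (r == a :> nat) = false by apply: negbTE.
have nar : (a == r :> nat) = false by rewrite eq_sym.
have nrc : (r == c :> nat) = false by apply: negbTE.
have nac : (a == c :> nat) = false by apply: negbTE.
apply: (comp_for (c := c) (b := a) (comp_inc r) (P := fun z e i e1 =>
  [/\ i <= e a, e1 r = e r + i & (forall q : nat, q != r -> q != c -> e1 q = e q)])).
- by move=> z e b e' [_ ->]; rewrite /upd eq_sym nrc.
- move=> z e; split; rewrite ?addn0 //; first by rewrite /upd nrc.
  by move=> q _ /negbTE; rewrite /upd => ->.
- move=> z e i e1 b e2 hi hiz [hle hr hq] hne [_ ->]; rewrite hq ?nar ?nac // in hne.
  split; first lia.
    by rewrite /upd nrc eqxx hr addnS.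
  by move=> q h1 h2; rewrite /upd (negbTE h1) (negbTE h2) hq.
- move=> z e i e1 hi [hle hr hq]; rewrite (hq a) ?nar ?nac // hr => h.
  split=> //; rewrite /eqv; lia.
Qed.

(** Repeated addition: [m] and [m.+1] hold the factors, [m.+2] accumulates, [m.+3] and [m.+4] count
    the outer and inner loops. This is the 5 in [term_cost]. *)
Lemma comp_mulinto (m : nat) : m + 5 <= K ->
  computes (fun z e _ e' => eqv z (e' m) (e m * e m.+1) /\ agree m e e').
Proof.
move=> hK.
have h0 : m < K by lia.
have h1 : m.+1 < K by lia.
have h2 : m.+2 < K by lia.
have h3 : m.+3 < K by lia.
have h4 : m.+4 < K by lia.
pose p0 := Ordinal h0; pose p1 := Ordinal h1; pose p2 := Ordinal h2.
pose p3 := Ordinal h3; pose p4 := Ordinal h4.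
have hadd : computes (fun z e _ e' => eqv z (e' m.+2) (e m.+2 + e m) /\
    forall q : nat, q != m.+2 -> q != m.+4 -> e' q = e q).
  by apply: (@comp_addto p2 p0 p4); rewrite -val_eqE /=; lia.
have hfor : computes (fun z e _ e' => e m.+2 = 0 ->
    eqv z (e' m.+2) (e m * e m.+1) /\ agree m e e').
  apply: (comp_for (c := p3) (b := p1) hadd (P := fun z e i e1 => e m.+2 = 0 ->
    [/\ i <= e m.+1, eqv z (e1 m.+2) (i * e m) & agree m.+2 e e1])).
  - by move=> z e _ e' [_ /= ->] //; lia.
  - move=> z e he; split; rewrite /upd //=; last by move=> q hq; case: eqP => //; lia.
    by rewrite ifF ?he; [left | lia].
  - move=> z e i e1 b' e2 hi hiz hP hne [hr hq] he; have {hP}[hle hr1 ha] := hP he.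
    rewrite /= ha // in hne; split; first lia.
      rewrite /upd /= ifF; last lia.
      apply: eqv_trans hr _; rewrite mulSn addnC; apply: eqv_add => //.
      by left; rewrite ha.
    move=> q hq'; rewrite /upd /= ifF; last lia.
    by rewrite hq ?ha //; lia.
  move=> z e i e1 hi hP hstop he; have {hP}[hle hr1 ha] := hP he.
  rewrite /= ha // in hstop; split; last by apply: agree_leq ha; lia.
  apply: eqv_trans hr1 _; rewrite mulnC; apply: eqv_mul; first by left.
  by rewrite /eqv; lia.
have hbody : computes (fun z e _ e' =>
    eqv z (e' m.+2) (e m * e m.+1) /\ agree m e e').
  apply: comp_seq (comp_zero p2) hfor _ => z e _ e1 _ e2 [_ ->] h.
  have [|hr ha] := h; first by rewrite /upd eqxx.
  split; last by apply: agree_trans ha; apply: agree_upd => /=; lia.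
  by move: hr; rewrite /upd /= !ifF //; lia.
apply: comp_seq hbody (comp_copy p0 p2) _ => z e _ e1 _ e2 [hr ha] [_ ->].
split; first by rewrite /upd eqxx.
exact/(agree_trans ha)/agree_upd.
Qed.

(** The value is left in pointer [m]. In a binary operation the second operand is evaluated from
    [m.+1] on, with [m] protected like one more variable. *)
Lemma comp_term t m : term_wf m t -> m + term_cost t <= K ->
  computes (fun z e _ e' => eqv z (e' m) (ev e t) /\ agree m e e').
Proof.
elim: t m => [p||t IHt|t IHt u IHu|t IHt u IHu] m /= wf hK.
- have h0 : m < K by lia.
  have h1 : p < K by lia.
  apply: comp_weaken (comp_copy (Ordinal h0) (Ordinal h1)) _ => z e _ e' [_ ->].
  by split; [left; rewrite /upd eqxx | apply: agree_upd].
- have h0 : m < K by lia.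
  apply: comp_weaken (comp_zero (Ordinal h0)) _ => z e _ e' [_ ->].
  by split; [left; rewrite /upd eqxx | apply: agree_upd].
- have h0 : m < K by have := term_cost_gt0 t; lia.
  apply: comp_seq (IHt m wf hK) (comp_inc (Ordinal h0)) _ => z e _ e1 _ e2 [hr ha] [_ ->].
  split; last exact/(agree_trans ha)/agree_upd.
  by rewrite /upd eqxx /=; move: hr; rewrite /eqv; lia.
- move: wf => /andP[wt wu].
  have h0 : m < K by lia.
  have h1 : m.+1 < K by lia.
  have h2 : m.+2 < K by lia.
  have hadd : computes (fun z e _ e' => eqv z (e' m) (e m + e m.+1) /\
      forall q : nat, q != m -> q != m.+2 -> e' q = e q).
    by apply: (@comp_addto (Ordinal h0) (Ordinal h1) (Ordinal h2)); rewrite -val_eqE /=; lia.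
  have wu' := term_wfW wu; have hKu : m.+1 + term_cost u <= K by lia.
  have hKt : m + term_cost t <= K by lia.
  apply: comp_seq (IHt m wt hKt) (comp_seq (IHu _ wu' hKu) hadd (R := fun z e _ e' =>
    eqv z (e' m) (e m + ev e u) /\ agree m e e') _) _.
    move=> z e _ e1 _ e2 [hr ha] [hr' hq]; split.
      apply: eqv_trans hr' _; apply: eqv_add hr; rewrite ha //; by left.
    by move=> q hq'; rewrite hq ?ha //; lia.
  move=> z e _ e1 _ e2 [hr ha] [hr' ha']; split; last exact: agree_trans ha'.
  apply: eqv_trans hr' _; apply: eqv_add hr _; rewrite (ev_agree wu ha).
  by left.
- move: wf => /andP[wt wu].
  have wu' := term_wfW wu; have hKu : m.+1 + term_cost u <= K by lia.
  have hKt : m + term_cost t <= K by lia.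
  have hmul : m + 5 <= K by lia.
  apply: comp_seq (IHt m wt hKt) (comp_seq (IHu _ wu' hKu) (comp_mulinto hmul)
    (R := fun z e _ e' => eqv z (e' m) (e m * ev e u) /\ agree m e e') _) _.
    move=> z e _ e1 _ e2 [hr ha] [hr' hq]; split.
      apply: eqv_trans hr' _; apply: eqv_mul hr; rewrite ha //; by left.
    by move=> q hq'; rewrite hq ?ha //; lia.
  move=> z e _ e1 _ e2 [hr ha] [hr' ha']; split; last exact: agree_trans ha'.
  apply: eqv_trans hr' _; apply: eqv_mul hr _; rewrite (ev_agree wu ha).
  by left.
Qed.

Definition decides m (P : seq isym -> env -> Prop) :=
  computes (fun z e b e' => (b <-> P z e) /\ agree m e e').

(** The answer of the machine replaces excluded middle when [fOr], [fImp] and [fAll] are reduced to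
    negation, conjunction and [fEx]. *)
Lemma decides_dec m P z e : decides m P -> P z e \/ ~ P z e.
Proof.
move=> [M [c [d h]]]; have [k [b [e' [_ _ [hb _]]]]] := h z e.
by case: b hb => hb; [left | right]; have := hb; intuition.
Qed.

Lemma decides_iff m P Q : (forall z e, P z e <-> Q z e) ->
  decides m P -> decides m Q.
Proof.
move=> hPQ h; apply: comp_weaken h _ => z e b e' [hb ha]; split=> //.
by rewrite hb.
Qed.

Lemma decides_not m P : decides m P -> decides m (fun z e => ~ P z e).
Proof.
move=> h; apply: comp_ite h (comp_ret K false) (comp_ret K true) _.
move=> z e b1 e1 b e2 [hb ha]; case: b1 hb => hb [-> ->]; split=> //.
  by have := hb; intuition.
by have := hb; intuition.
Qed.

Definition depends m (P : seq isym -> env -> Prop) :=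
  forall z e e', agree m e e' -> P z e' <-> P z e.

Lemma decides_and m P Q : depends m Q -> decides m P -> decides m Q ->
  decides m (fun z e => P z e /\ Q z e).
Proof.
move=> hQ h h'; apply: comp_ite h h' (comp_ret K false) _.
move=> z e b1 e1 b e2 [hb ha]; case: b1 hb => hb [].
  move=> hb' ha'; split; last exact: agree_trans ha'.
  by rewrite hb' (hQ z _ _ ha); split=> [h1|[] //]; split=> //; apply/hb.
by move=> -> ->; split=> //; split=> // -[/hb].
Qed.

(** Exhaustive search: pointer [m] starts at 0 and moves past every non-witness; a witness exists
    exactly when [m] is still on the word at the end. *)
Lemma decides_ex m P : m < K -> depends m.+1 P -> decides m.+1 P ->
  decides m (fun z e => exists2 v, v < size z & P z (upd e m v)).
Proof.
move=> hm hP h; pose pm := Ordinal hm.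
have hb : computes (fun z e b e' => if b then e m < size z /\ ~ P z e /\
     agree m e e' /\ e' m = (e m).+1
   else agree m.+1 e e' /\ (e m < size z -> P z e)).
  have hi : computes (fun z e b e' => if b then ~ P z e /\ agree m e e' /\ e' m = (e m).+1
     else agree m.+1 e e' /\ P z e).
    apply: comp_ite h (comp_ret K false) (comp_inc pm) _.
    move=> z e b1 e1 b e2 [hb ha]; case: b1 hb => hb [-> ->].
      by split=> //; apply/hb.
    split; first by move/hb.
    split.
      by apply: (agree_trans (agree_leq (leqnSn m) ha)); apply: agree_upd.
    by rewrite /upd eqxx /= ha.
  apply: comp_ite (comp_set pm) hi (comp_ret K false) _.
  move=> z e b1 e1 b e2 [-> ->]; case: ltnP => hlt.
    by case: b => h'; split=> //; [exact: h'.1 | move=> _; exact: h'.2].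
  by move=> [-> ->]; split=> // hlt'; rewrite leqNgt hlt' in hlt.
(* A machine must be specified from every environment, hence the premise [e m = 0]; the reset placed
   before the loop supplies it. *)
have hl : computes (fun z e b e' => e m = 0 -> agree m e e' /\
    (e' m < size z -> P z e') /\ forall v, v < e' m -> v < size z -> ~ P z (upd e m v)).
  apply: (comp_loop (P := fun z e i e1 => i <= e1 m /\ (e m = 0 -> agree m e e1 /\
    forall v, v < e1 m -> v < size z -> ~ P z (upd e m v))) hb).
    by move=> z e; split=> // he; split=> // v; rewrite he.
  move=> z e i e1 b e2 [hi h0]; case: b; last first.
    move=> [ha hlt] he; have [ha0 hv] := h0 he; split.
      by apply: agree_trans ha0 _; apply: agree_leq (leqnSn m) ha.
    rewrite ha //; split=> // ht; apply/(hP _ _ _ ha); exact: hlt.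
  move=> [hlt [hn [ha hi2]]]; split; first lia.
  rewrite hi2; split; first lia.
  move=> he; have [ha0 hv] := h0 he; split; first exact: agree_trans ha.
  move=> v hv1 hv2; have [hve|hve] := ltnP v (e1 m); first exact: hv.
  have {hve hv1} -> : v = e1 m by lia.
  move=> hp; apply: hn; apply/hP; last exact: hp.
  move=> q hq; rewrite /upd; case: eqP => [-> //|hne]; apply: ha0; lia.
have ht : computes (fun z e b e' => e m = 0 -> agree m e e' /\
    (b <-> exists2 v, v < size z & P z (upd e m v))).
  apply: comp_seq hl (comp_set pm) _ => z e _ e1 b e2 h1 [-> ->] he.
  have [ha [hin hv]] := h1 he; split=> //; split=> [hlt | [v hvz hpv]].
    exists (e1 m) => //; apply/hP; last exact: hin.
    by move=> q hq; rewrite /upd; case: eqP => [-> //|hne]; rewrite ha //; lia.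
  rewrite ltnNge; apply/negP => hge; apply: hv hpv => //; exact: leq_trans hge.
apply: comp_seq (comp_zero pm) ht _ => z e _ e1 b e2 [_ ->] h1.
have [|ha hb'] := h1; first by rewrite /upd eqxx.
split; last by apply: agree_trans ha; apply: agree_upd.
have eqP v : P z (upd (upd e m 0) m v) <-> P z (upd e m v).
  by apply: hP => q hq; rewrite /upd; case: eqP.
by rewrite hb'; split=> -[v hv /eqP hpv]; exists v.
Qed.

Lemma decides_eq m t u : term_wf m t -> term_wf m u ->
  m + maxn (term_cost t) (term_cost u).+1 <= K -> decides m (sem m (fEq t u)).
Proof.
move=> wt wu hK; have hc := term_cost_gt0 u.
have h0 : m < K by lia.
have h1 : m.+1 < K by lia.
have hu : computes (fun z e b e' => agree m.+1 e e' /\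
    (b <-> e m < size z /\ e m = ev e u)).
  apply: comp_seq (comp_term (term_wfW wu) _) (comp_eq (Ordinal h0) (Ordinal h1)) _; first lia.
  move=> z e _ e1 b e2 [hr ha] [-> ->]; split=> //=.
  rewrite (ha m) //; move: hr; rewrite /eqv => hr; split.
    by move=> /andP[hlt /eqP heq]; lia.
  by case=> hlt heq; apply/andP; split=> //; apply/eqP; lia.
apply: comp_seq (comp_term wt _) hu _; first lia.
move=> z e _ e1 b e2 [hr ha] [ha' hb]; split; last by apply: agree_trans ha _; apply: agree_leq (leqnSn m) ha'.
rewrite (ev_agree wu ha) in hb; move: hr; rewrite /eqv => hr.
by rewrite hb /=; split=> hh; lia.
Qed.

Lemma decides_sym m a t : term_wf m t -> m + term_cost t <= K ->
  decides m (sem m (fSym a t)).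
Proof.
move=> wt hK; have hc := term_cost_gt0 t.
have h0 : m < K by lia.
apply: comp_seq (comp_term wt hK) (comp_sym a (Ordinal h0)) _.
move=> z e _ e1 b e2 [hr ha] [-> ->]; split=> //=.
case: hr => [->|[hr1 hr2]]; first by split=> [/andP[hlt /eqP] | [-> ->]] //=.
by split=> [/andP[hlt _] | [hlt _]]; exfalso; lia.
Qed.

Lemma decides_form f m : form_wf m f -> m + form_cost f <= K ->
  decides m (sem m f).
Proof.
elim: f m => [a t|t u|t u|f IHf|f IHf g IHg|f IHf g IHg|f IHf g IHg|f IHf|f IHf] m;
  rewrite [form_wf _ _]/= [form_cost _]/=.
- exact: decides_sym.
- by move=> /andP[wt wu]; apply: decides_eq.
- move=> /andP[wt wu] hK.
  pose h := fEx (fEq (tSucc (tAdd t (tVar m))) u).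
  have wh : form_wf m.+1 (fEq (tSucc (tAdd t (tVar m))) u).
    by rewrite /= ltnSn !term_wfW.
  apply: (@decides_iff m (sem m h)).
    move=> z e; rewrite /h /=; split=> [[v hv] | [h1 h2]].
      rewrite !(ev_agree _ (agree_upd v e (leqnn m))) // /upd eqxx; lia.
    exists (ev e u - (ev e t).+1); first lia.
    by rewrite !(ev_agree _ (agree_upd _ e (leqnn m))) // /upd eqxx; lia.
  apply: (@decides_ex m (sem m.+1 (fEq (tSucc (tAdd t (tVar m))) u))); first lia.
    by move=> z e e'; apply: sem_agree.
  by apply: decides_eq => //=; rewrite ?ltnSn ?term_wfW //; lia.
- by move=> wf hK; apply/decides_not/IHf.
- move=> /andP[wf wg] hK; apply: (@decides_and m (sem m f) (sem m g)); [|apply: IHf|apply: IHg] => //; try lia.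
  by move=> z e e'; apply: sem_agree.
- move=> /andP[wf wg] hK.
  have df : decides m (sem m f) by apply: IHf => //; lia.
  have dg : decides m (sem m g) by apply: IHg => //; lia.
  apply: (@decides_iff m (fun z e => ~ (~ sem m f z e /\ ~ sem m g z e))).
    by move=> z e /=; have := decides_dec z e df; have := decides_dec z e dg; tauto.
  apply/decides_not/decides_and; [|exact: decides_not..].
  by move=> z e e' ha; have := sem_agree z wg ha; tauto.
- move=> /andP[wf wg] hK.
  have df : decides m (sem m f) by apply: IHf => //; lia.
  have dg : decides m (sem m g) by apply: IHg => //; lia.
  apply: (@decides_iff m (fun z e => ~ (sem m f z e /\ ~ sem m g z e))).
    by move=> z e /=; have := decides_dec z e df; have := decides_dec z e dg; tauto.
  apply/decides_not/decides_and; [|exact: df|exact: decides_not].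
  by move=> z e e' ha; have := sem_agree z wg ha; tauto.
- move=> wf hK; apply: (@decides_ex m (sem m.+1 f)); [lia | | by apply: IHf => //; lia].
  by move=> z e e'; apply: sem_agree.
- move=> wf hK.
  have df : decides m.+1 (sem m.+1 f) by apply: IHf => //; lia.
  apply: (@decides_iff m (fun z e =>
      ~ exists2 v, v < size z & ~ sem m.+1 f z (upd e m v))).
    move=> z e /=; split=> h; last by case=> w hw; apply; apply: h.
    move=> v hv; have := decides_dec z (upd e m v) df; case=> // hn.
    by case: h; exists v.
  apply/decides_not/(decides_ex (P := fun z e => ~ sem m.+1 f z e)); [lia | | exact: decides_not].
  by move=> z e e' ha; have := sem_agree z wf ha; tauto.
Qed.

End Compile.

(** The verifier decides the sentence on all words within the same bound; completeness asks for one
    short certificate, soundness must hold for certificates of any length. *)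
Lemma NP_of_form (L : seq isym -> Prop) (f : form) (c d : nat) :
  form_wf 0 f ->
  (forall x, L x -> exists2 y, size y <= c * (size x).+1 ^ d &
     sem 0 f (x ++ IHash :: y) (fun _ => 0)) ->
  (forall x y, sem 0 f (x ++ IHash :: y) (fun _ => 0) -> L x) ->
  in_NP L.
Proof.
move=> wf hcomplete hsound; have [M [c1 [d1 h]]] := decides_form wf (leqnn (form_cost f)).
(* [C] and [D] dominate both the certificate bound and the running time, in which a pass of
   [2 * n + 2] steps costs one more degree. The factor [2 ^ D] used with them passes from [n.+1 ^ D]
   to [n ^ D + 1], the shape of [poly]. *)
pose C := c + c1 * 4; pose D := (d + d1).+1.
have cost n : c * n.+1 ^ d <= poly (C * 2 ^ D) D n /\
    c1 * n.+1 ^ d1 * (2 * n + 2) <= poly (C * 2 ^ D) D n.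
  have le2 : n.+1 ^ D <= 2 ^ D * (n ^ D + 1).
    case: (posnP n) => [->|hn]; first by rewrite exp1n muln_gt0 expn_gt0 addn1.
    apply: (@leq_trans ((2 * n) ^ D)); first by rewrite leq_exp2r //; lia.
    by rewrite expnMn leq_mul // leq_addr.
  have polyE : C * (2 ^ D * (n ^ D + 1)) = poly (C * 2 ^ D) D n.
    by rewrite /poly mulnA mulnDr muln1.
  rewrite -polyE; split.
    apply: leq_mul; first exact: leq_addr.
    by apply: leq_trans le2; apply: leq_pexp2l; rewrite /D; lia.
  apply: (@leq_trans (c1 * 4 * n.+1 ^ D)); last by apply: leq_mul => //; apply: leq_addl.
  have le1 : n.+1 * n.+1 ^ d1 <= n.+1 ^ D.
    by rewrite -expnS; apply: leq_pexp2l; rewrite /D; lia.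
  rewrite (_ : _ * (2 * n + 2) = c1 * 2 * (n.+1 * n.+1 ^ d1)); last nia.
  by apply: leq_mul => //; lia.
exists (tm_of M), (C * 2 ^ D), D.
have run z : exists2 b : bool, (b <-> sem 0 f z (fun _ => 0)) &
    state_after (tm_of M) z (poly (C * 2 ^ D) D (size z)) = haltQ M b.
  (* The initial, unmarked tape is that of an environment with every pointer beyond the word; the
     sentence being closed, its truth is the same in all environments. *)
  have [k [b [e' [hk hr [hb _]]]]] := h z (fun _ => size z).
  exists b; first by rewrite hb; apply: sem_agree.
  have tapeE : [seq (a, set0) | a <- z] = tape (form_cost f) z (fun _ => size z).
    rewrite /tape -[in LHS](mkseq_nth I0 z) -map_comp; apply/eq_in_map => i.
    rewrite mem_iota => /andP[_ hi] /=; congr (_, _); apply/setP => p.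
    by rewrite !inE; lia.
  apply: (@state_after_runs _ M z k b (tape _ z e')); first by rewrite tapeE.
  by have [_] := cost (size z); apply: leq_trans; apply: leq_mul.
split=> [z | x]; first by have [[] _ ->] := run z; [left | right].
split=> [/hcomplete[y hy hs] | [y [_]]].
  exists y; split; first by have [le _] := cost (size x); apply: leq_trans le.
  by have [b hb ->] := run (x ++ IHash :: y); move/hb: hs => ->.
have [[] hb ->] := run (x ++ IHash :: y); last by case.
by move=> _; apply: (hsound x y); apply/hb.
Qed.

(** * Codes of natural numbers *)

Definition codes (L : seq nat) : seq isym := flatten (map enc_nat L).
Arguments codes : simpl never.

Lemma codes_cons v L : codes (v :: L) = enc_nat v ++ codes L.
Proof. by []. Qed.

Lemma codes_cat L1 L2 : codes (L1 ++ L2) = codes L1 ++ codes L2.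
Proof. by rewrite /codes map_cat flatten_cat. Qed.

Lemma bin_aux_fuel f g k : k <= f -> k <= g -> bin_aux f k = bin_aux g k.
Proof.
elim: f g k => [|f IHf] [|g] [|k] //= hf hg.
by congr (_ :: _); apply: IHf; lia.
Qed.

Lemma enc_nat_pos v : 0 < v ->
  enc_nat v = (if odd v then I1 else I0) :: enc_nat v./2.
Proof.
case: v => // v _; rewrite /enc_nat [bin_aux v.+1 _]/= cat_cons.
by rewrite (@bin_aux_fuel v (v.+1)./2) //; lia.
Qed.

Lemma enc_nat_ind (P : nat -> Prop) :
  P 0 -> (forall v, 0 < v -> P v./2 -> P v) -> forall v, P v.
Proof.
move=> h0 hS v; have [n] := ubnP v; elim: n v => // n IHn v hv.
by case: (posnP v) => [->|hp] //; apply: (hS) => //; apply: IHn; lia.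
Qed.

Lemma enc_nat_inj : injective enc_nat.
Proof.
move=> u; elim/enc_nat_ind: u => [|u hu IHu] v.
  by case: (posnP v) => [->|hv] //; rewrite (enc_nat_pos hv); case: (odd v).
rewrite (enc_nat_pos hu); case: (posnP v) => [->|hv].
  by rewrite /enc_nat /=; case: (odd u).
rewrite (enc_nat_pos hv).
move=> [ho /IHu hh]; rewrite -[u]odd_double_half -[v]odd_double_half hh.
by move: ho; case: (odd u); case: (odd v).
Qed.

Lemma size_enc_nat_gt0 v : 0 < size (enc_nat v).
Proof. by rewrite size_cat addnS. Qed.

(** A separator ends a code and occurs nowhere else in it, so the first one met reveals the length
    of the code whatever follows. *)
Lemma nth_enc_nat_sep v s d :
  (forall r, r < d -> nth IHash (enc_nat v ++ s) r <> ISep) ->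
  nth IHash (enc_nat v ++ s) d = ISep -> d.+1 = size (enc_nat v).
Proof.
elim/enc_nat_ind: v d => [|v hv IHv] d.
  by case: d => //= d h _; case: (h 0).
rewrite enc_nat_pos //; case: d => [|d] h /=; first by case: ifP.
by move=> hd; congr _.+1; apply: IHv => // r hr; apply: (h r.+1).
Qed.

Lemma nth_enc_nat_lt v s r : r.+1 < size (enc_nat v) ->
  nth IHash (enc_nat v ++ s) r = I0 \/ nth IHash (enc_nat v ++ s) r = I1.
Proof.
elim/enc_nat_ind: v r => [|v hv IHv] r //.
rewrite enc_nat_pos //; case: r => [|r] /=; last exact: IHv.
by case: ifP; [right | left].
Qed.

Lemma nth_enc_nat_last v s : nth IHash (enc_nat v ++ s) (size (enc_nat v)).-1 = ISep.
Proof. by rewrite /enc_nat size_cat addn1 /= -catA nth_cat ltnn subnn. Qed.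

(** Only 0 has no binary digit; one symbol thus decides whether a label is [eps]. *)
Lemma nth_enc_nat0 v s : nth IHash (enc_nat v ++ s) 0 = ISep <-> v = 0.
Proof.
split=> [|->] //; case: (posnP v) => // hv.
by rewrite enc_nat_pos //=; case: ifP.
Qed.

Definition canonical_adj (a b : isym) := (a == I0) ==> (b != ISep).

Lemma codes_canonical L :
  sorted canonical_adj (codes L) /\ last ISep (codes L) = ISep.
Proof.
elim: L => // v L [IH1 IH2]; rewrite codes_cons; split.
  elim/enc_nat_ind: v => [|v hv IHv].
    by move: IH1; rewrite [enc_nat 0]/=; case: (codes L).
  rewrite enc_nat_pos //=; case: ifP => ho.
    by move: IHv; case: (enc_nat _ ++ _) => //= a s ->.
  move: IHv; case: (posnP v./2) => [|h2]; first lia.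
  by rewrite enc_nat_pos //=; case: ifP => _ ->.
by rewrite last_cat /enc_nat last_cat.
Qed.

Lemma codes_nohash L : IHash \notin codes L.
Proof.
elim: L => // v L IH; rewrite codes_cons mem_cat negb_or IH andbT.
elim/enc_nat_ind: v => [|v hv IHv] //.
by rewrite enc_nat_pos // in_cons negb_or IHv andbT; case: ifP.
Qed.

(** The tail is decoded before the head: a separator in front opens a new code, of 0, and a bit [b]
    in front turns the first number [v] into [2 * v + b]. Canonicity excludes a bit 0 before the
    code of 0, and the final separator excludes a bit with no code after it. *)
Lemma codes_parse s : IHash \notin s -> sorted canonical_adj s ->
  last ISep s = ISep -> exists L, s = codes L.
Proof.
elim: s => [|a s IHs]; first by exists [::].
rewrite in_cons negb_or => /andP[ha hs] hsort hlast.
have hsort' : sorted canonical_adj s by move: hsort => /= /path_sorted.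
have hlast' : last ISep s = ISep.
  by move: hlast; case: (s).
have [L hL] := IHs hs hsort' hlast'.
case: a ha hsort hlast => //= _ hsort hlast; last by exists (0 :: L); rewrite hL.
  case: L hL => [|v L] hL; first by rewrite hL in hlast.
  exists (v.*2 :: L); rewrite codes_cons enc_nat_pos ?odd_double ?doubleK ?hL //.
  case: (posnP v) => [hv|]; last lia.
  by move: hsort; rewrite hL hv.
case: L hL => [|v L] hL; first by rewrite hL in hlast.
exists (v.*2.+1 :: L); rewrite codes_cons enc_nat_pos //= odd_double uphalf_double.
by rewrite hL.
Qed.

Lemma mkseq_table (T : Type) (f : nat -> nat -> T) n m :
  [seq f i j | i <- iota 0 n, j <- iota 0 m] =
  mkseq (fun u => f (u %/ m) (u %% m)) (n * m).
Proof.
case: (posnP m) => [->|hm].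
  by rewrite muln0; elim: (iota 0 n) => //= a s ->.
elim: n => [|n IHn]; first by rewrite mul0n.
rewrite -addn1 iotaD allpairs_cat IHn /= cats0 mulnDl mul1n /mkseq iotaD map_cat.
congr (_ ++ _); rewrite add0n -[in iota (n * m)](addn0 (n * m)) iotaDl -map_comp.
apply/eq_in_map => j; rewrite mem_iota => /andP[_ hj] /=.
by rewrite divnMDl // modnMDl divn_small // modn_small // addn0.
Qed.

Definition ord_rel n (r : rel 'I_n) (i j : nat) : bool :=
  if insub i is Some a then if insub j is Some b then r a b else false else false.

Lemma ord_relE n (r : rel 'I_n) (a b : 'I_n) : ord_rel r a b = r a b.
Proof. by rewrite /ord_rel !valK. Qed.

Definition bit_sym (b : bool) := if b then I1 else I0.

Lemma enc_relE n (r : rel 'I_n) (r' : nat -> nat -> bool) :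
  (forall a b : 'I_n, r a b = r' a b) ->
  enc_rel r = mkseq (fun u => bit_sym (r' (u %/ n) (u %% n))) (n * n).
Proof.
move=> h; rewrite -(mkseq_table (fun i j => bit_sym (r' i j))) -val_enum_ord.
rewrite allpairs_mapl allpairs_mapr.
by apply: eq_allpairs => // a b; rewrite h.
Qed.

(** * The sentence expressing membership *)

(** [m] is the number of variables already in scope, hence the level that the quantifier binds. *)
Definition fAllLt m t (f : term -> form) := fAll (fImp (fLt (tVar m) t) (f (tVar m))).
Definition fExLt m t (f : term -> form) := fEx (fAnd (fLt (tVar m) t) (f (tVar m))).
Definition fAllT m (f : term -> form) := fAll (f (tVar m)).
Definition fBit t := fOr (fSym I0 t) (fSym I1 t).

Definition xsize := tVar 0.
Definition nevents := tVar 1.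
Definition ntrace := tVar 2.

(** Layout of an instance with [n] events: [n] ones, a separator, the table of causality, a
    separator, the table of conflict, a separator, the codes. *)
Definition lt_pos i j := tAdd (tSucc nevents) (tAdd (tMul i nevents) j).
Definition lt_end := tAdd (tSucc nevents) (tMul nevents nevents).
Definition cf_pos i j := tAdd (tSucc lt_end) (tAdd (tMul i nevents) j).
Definition cf_end := tAdd (tSucc lt_end) (tMul nevents nevents).
Definition lab_start := tSucc cf_end.

Definition fltE i j := fSym I1 (lt_pos i j).
Definition fcfE i j := fSym I1 (cf_pos i j).

(* The word [x # y] is read as a table of rows of length [|x| + 1]: row 0 is
   [x #], and the certificate [y] is a sequence of square relations. *)
Definition fRel r i j :=
  fAnd (fLt i (tSucc xsize)) (fAnd (fLt j (tSucc xsize))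
    (fSym I1 (tAdd (tMul (tSucc (tAdd (tMul r (tSucc xsize)) i)) (tSucc xsize)) j))).

(* [fTrace k i]: event [i] is the [k]-th of the trace.
   [fStart i s]: the code of the label of event [i] starts at position [s].
   [fWord k p]: after [k] events, the rest of the word starts at position [p]. *)
Definition fTrace := fRel tZero.
Definition fStart := fRel (tSucc tZero).
Definition fWord := fRel (tSucc (tSucc tZero)).

Definition fAnds := foldr fAnd (fEq tZero tZero).

(** The hash is unique in the whole of [x # y], so [x] contains none and its length is determined.
    The last two conjuncts make the codes canonical and complete: [x] has to equal an encoding, not
    merely to describe an instance. *)
Definition input_form := fAnds [::
  fSym IHash xsize;
  fAllT 3 (fun i => fImp (fSym IHash i) (fEq i xsize));
  fSym ISep nevents;
  fAllLt 3 nevents (fun i => fSym I1 i);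
  fAllLt 3 nevents (fun i => fAllLt 4 nevents (fun j =>
    fAnd (fBit (lt_pos i j)) (fBit (cf_pos i j))));
  fSym ISep lt_end;
  fSym ISep cf_end;
  fAllLt 3 xsize (fun p => fImp (fLt cf_end p) (fImp (fSym I0 p)
    (fNot (fSym ISep (tSucc p)))));
  fAllLt 3 xsize (fun p => fImp (fEq (tSucc p) xsize) (fSym ISep p))].

Definition event_form := fAnds [::
  fAllLt 3 nevents (fun i => fAnd (fNot (fltE i i)) (fNot (fcfE i i)));
  fAllLt 3 nevents (fun i => fAllLt 4 nevents (fun j => fImp (fcfE i j) (fcfE j i)));
  fAllLt 3 nevents (fun i => fAllLt 4 nevents (fun j => fAllLt 5 nevents (fun k =>
    fImp (fltE j k) (fAnd (fImp (fltE i j) (fltE i k)) (fImp (fcfE i j) (fcfE i k))))));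
  fExLt 3 nevents (fun b => fAnd
    (fAllLt 4 nevents (fun e => fAnd (fNot (fltE e b)) (fOr (fEq e b) (fltE b e))))
    (fAllT 4 (fun s => fImp (fStart b s) (fSym ISep s))))].

(** The separator between the labels and the word is itself the code of 0. It is treated as entry
    [n] of a single list of codes, and the word begins just after it. *)
Definition start_form := fAnds [::
  fStart tZero lab_start;
  fAllLt 3 nevents (fun i => fAllT 4 (fun s => fImp (fStart i s)
    (fExLt 5 xsize (fun q => fAnds [::
       fLt s (tSucc q); fSym ISep q;
       fAllLt 6 q (fun r => fImp (fLt s (tSucc r)) (fNot (fSym ISep r)));
       fStart (tSucc i) (tSucc q)]))));
  fAllT 3 (fun s => fImp (fStart nevents s)
    (fAnd (fSym ISep s) (fWord tZero (tSucc s))))].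

(** The fourth conjunct, that causes occur earlier, yields both the left closure of the
    configuration and the order condition on traces. *)
Definition trace_form := fAnds [::
  fAllLt 3 ntrace (fun k => fExLt 4 nevents (fun i => fTrace k i));
  fAllLt 3 ntrace (fun k => fAllLt 4 nevents (fun i => fAllLt 5 nevents (fun j =>
    fImp (fTrace k i) (fImp (fTrace k j) (fEq i j)))));
  fAllLt 3 ntrace (fun k => fAllLt 4 ntrace (fun l => fAllLt 5 nevents (fun i =>
    fImp (fTrace k i) (fImp (fTrace l i) (fEq k l)))));
  fAllLt 3 ntrace (fun k => fAllLt 4 nevents (fun i => fAllLt 5 nevents (fun j =>
    fImp (fTrace k i) (fImp (fltE j i) (fExLt 6 k (fun l => fTrace l j))))));
  fAllLt 3 ntrace (fun k => fAllLt 4 ntrace (fun l =>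
    fAllLt 5 nevents (fun i => fAllLt 6 nevents (fun j =>
    fImp (fTrace k i) (fImp (fTrace l j) (fNot (fcfE i j)))))));
  fAllLt 3 nevents (fun e => fOr (fExLt 4 ntrace (fun k => fTrace k e))
    (fExLt 4 nevents (fun e' => fOr
      (fAnd (fltE e' e) (fAllLt 5 ntrace (fun k => fNot (fTrace k e'))))
      (fAnd (fcfE e e') (fExLt 5 ntrace (fun k => fTrace k e'))))))].

(** An empty label consumes nothing. Otherwise [d] is the common length of two runs of equal bits,
    each ended by a separator, and the position moves past the code. *)
Definition word_form := fAnds [::
  fAllLt 3 ntrace (fun k => fAllLt 4 nevents (fun i => fAllT 5 (fun s =>
    fAllT 6 (fun p => fImp (fTrace k i) (fImp (fStart i s) (fImp (fWord k p)
      (fOr (fAnd (fSym ISep s) (fWord (tSucc k) p))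
      (fAnd (fNot (fSym ISep s)) (fExLt 7 xsize (fun d => fAnds [::
        fSym ISep (tAdd s d); fSym ISep (tAdd p d);
        fAllLt 8 d (fun r => fOr
          (fAnd (fSym I0 (tAdd s r)) (fSym I0 (tAdd p r)))
          (fAnd (fSym I1 (tAdd s r)) (fSym I1 (tAdd p r))));
        fWord (tSucc k) (tSucc (tAdd p d))]))))))))));
  fAllT 3 (fun p => fImp (fWord ntrace p) (fEq p xsize))].

Definition membership_form :=
  fEx (fEx (fEx (fAnds [:: input_form; event_form; start_form; trace_form; word_form]))).

Lemma membership_form_wf : form_wf 0 membership_form.
Proof. by []. Qed.

(** * Soundness *)

Definition is_bit (a : isym) := a = I0 \/ a = I1.

(* [IHash] is the default value: it is not a symbol of [x], so a cell that reads
   as a bit or a separator lies inside [x]. *)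
Lemma split_nth (s : seq isym) p a : a <> IHash -> nth IHash s p = a ->
  p < size s /\ s = take p s ++ a :: drop p.+1 s.
Proof.
move=> ha hp; have hlt : p < size s.
  by rewrite ltnNge; apply/negP => hge; apply: ha; rewrite -hp nth_default.
by split=> //; rewrite -hp -drop_nth // cat_take_drop.
Qed.

Lemma take_bits (s : seq isym) k : k <= size s ->
  (forall u, u < k -> is_bit (nth IHash s u)) ->
  take k s = mkseq (fun u => bit_sym (nth IHash s u == I1)) k.
Proof.
move=> hk hbit; apply: (@eq_from_nth _ IHash) => [|u].
  by rewrite size_takel // size_mkseq.
rewrite size_takel // => hu; rewrite nth_take // nth_mkseq //.
by case: (hbit u hu) => ->.
Qed.

(** * Decoding an instance *)

Section Parse.
Variables (x : seq isym) (n : nat).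
Local Notation at_ p := (nth IHash x p).
Local Notation lt_end := (n.+1 + n * n).
Local Notation cf_end := (lt_end.+1 + n * n).

Lemma input_parse :
  IHash \notin x -> at_ n = ISep -> (forall i, i < n -> at_ i = I1) ->
  (forall u, u < n * n -> is_bit (at_ (n.+1 + u))) -> at_ lt_end = ISep ->
  (forall u, u < n * n -> is_bit (at_ (lt_end.+1 + u))) -> at_ cf_end = ISep ->
  (forall p, cf_end < p -> at_ p = I0 -> at_ p.+1 <> ISep) ->
  (forall p, p.+1 = size x -> at_ p = ISep) ->
  exists L, x = nseq n I1 ++
    ISep :: mkseq (fun u => bit_sym (at_ (n.+1 + u) == I1)) (n * n) ++
    ISep :: mkseq (fun u => bit_sym (at_ (lt_end.+1 + u) == I1)) (n * n) ++
    ISep :: codes L /\ drop cf_end.+1 x = codes L.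
Proof.
move=> hx hn hones hlt hlte hcf hcfe hcan hlast.
have [hn1 {1}->] := split_nth (a := ISep) (fun h => ltac:(discriminate h)) hn.
have [hl1 _] := split_nth (a := ISep) (fun h => ltac:(discriminate h)) hlte.
have [hc1 _] := split_nth (a := ISep) (fun h => ltac:(discriminate h)) hcfe.
set x1 := drop n.+1 x; set x2 := drop lt_end.+1 x; set x3 := drop cf_end.+1 x.
have e1 : x1 = take (n * n) x1 ++ ISep :: x2.
  have [||_ {1}->] := @split_nth x1 (n * n) ISep; rewrite ?nth_drop //.
  by rewrite drop_drop; congr (_ ++ _ :: drop _ _); lia.
have e2 : x2 = take (n * n) x2 ++ ISep :: x3.
  have [||_ {1}->] := @split_nth x2 (n * n) ISep; rewrite ?nth_drop //.
  by rewrite drop_drop; congr (_ ++ _ :: drop _ _); lia.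
have [L hL] : exists L, x3 = codes L.
  apply: codes_parse.
  - by apply: contra hx; apply: mem_drop.
  - apply/(sortedP IHash) => i hi; rewrite !nth_drop /canonical_adj.
    apply/implyP => /eqP h0; apply/eqP; rewrite addnS; apply: hcan => //; lia.
  - case: (posnP (size x3)) => [/size0nil -> // | h3].
    rewrite (last_nth IHash) -(prednK h3) /=.
    rewrite nth_drop; apply: hlast; move: h3; rewrite size_drop; lia.
exists L; split=> //; rewrite e1 e2 hL; congr (_ ++ _ :: _ ++ _ :: _ ++ _).
- apply: (@eq_from_nth _ IHash) => [|i]; rewrite size_takel ?size_nseq //; try lia.
  by move=> hi; rewrite nth_take // nth_nseq hi hones.
- rewrite take_bits; first by apply/eq_mkseq => u; rewrite nth_drop.
    by rewrite size_drop; lia.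
  by move=> u hu; rewrite nth_drop; apply: hlt.
- rewrite take_bits; first by apply/eq_mkseq => u; rewrite nth_drop.
    by rewrite size_drop; lia.
  by move=> u hu; rewrite nth_drop; apply: hcf.
Qed.

End Parse.

(** * From a trace relation to a maximal configuration *)

Section Trace.
Variables (E : fles) (hE : is_fles E) (m : nat) (T : nat -> 'I_(nev E) -> bool).
Hypothesis T_ex : forall k, k < m -> exists i, T k i.
Hypothesis T_fun : forall k i j, k < m -> T k i -> T k j -> i = j.
Hypothesis T_inj : forall k l i, k < m -> l < m -> T k i -> T l i -> k = l.
Hypothesis T_lt : forall k i j, k < m -> T k i -> evlt E j i ->
  exists2 l, l < k & T l j.
Hypothesis T_cf : forall k l i j, k < m -> l < m -> T k i -> T l j -> ~~ evcf E i j.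
Hypothesis T_max : forall e, (exists2 k, k < m & T k e) \/
  exists e', (evlt E e' e /\ forall k, k < m -> ~ T k e') \/
             (evcf E e e' /\ exists2 k, k < m & T k e').

(** Maximality is by induction on the number of causes of an event of a larger configuration [C']
    lying outside [C]. Either it has a cause outside [C], which is in [C'] by left closure and has
    fewer causes, or it conflicts with an event of [C], against the conflict freeness of [C']. *)
Lemma trace_sound : exists C t,
  [/\ is_max_config E C, is_trace E C t, size t = m &
      forall e0 k, k < m -> T k (nth e0 t k)].
Proof.
case: (hE) => [[lt_irr lt_tr] cf_irr cf_sym cf_lt [bot _]].
pose t := mkseq (fun k => odflt bot [pick i | T k i]) m.
have tT e0 k : k < m -> T k (nth e0 t k).
  move=> hk; rewrite nth_mkseq //; case: pickP => // h.
  by have [i] := T_ex hk; rewrite h.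
have st : size t = m by rewrite size_mkseq.
have mem_t e : (e \in t) <-> exists2 k, k < m & T k e.
  split=> [he | [k hk hT]].
    exists (index e t); first by rewrite -st index_mem.
    by rewrite -[in X in T _ X](nth_index bot he); apply: tT; rewrite -st index_mem.
  by rewrite (T_fun hk hT (tT bot k hk)); apply: mem_nth; rewrite st.
have t_uniq : uniq t.
  apply/(uniqP bot) => k l; rewrite !inE st => hk hl h.
  by apply: (T_inj hk hl (tT bot k hk)); rewrite h; apply: tT.
pose C := [set e in t].
have hC e : (e \in C) <-> exists2 k, k < m & T k e by rewrite inE mem_t.
have cfgC : is_config E C.
  split=> [e e' /hC[k hk hT] hlt | e e' /hC[k hk hT] /hC[l hl hT']].
    have [l hl hT'] := T_lt hk hT hlt; apply/hC; exists l => //.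
    exact: ltn_trans hk.
  exact: T_cf hT hT'.
exists C, t; split=> //.
  split=> // C' [lc' cf'] sub; apply/eqP; rewrite eqEsubset sub andbT.
  apply/subsetP => e; apply: contraTT => eC; apply/negP => eC'.
  have [k] := ubnP #|[set a | evlt E a e]|.
  elim: k e eC eC' => // k IH e eC eC' hk.
  have [/hC|[e' [[hlt hno]|[hcf [l hl hT]]]]] := T_max e; first by rewrite (negbTE eC).
    apply: (IH e').
    - by apply/negP => /hC[l hl]; apply: hno.
    - exact: lc' hlt.
    move: hk; rewrite ltnS; apply: leq_trans; apply/proper_card/properP; split.
      by apply/subsetP => a; rewrite !inE => ha; apply: lt_tr hlt.
    by exists e'; rewrite !inE ?hlt // lt_irr.
  have e'C : e' \in C' by apply: (subsetP sub); apply/hC; exists l.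
  by have := cf' _ _ eC' e'C; rewrite hcf.
split=> // [e|e0 k l]; first by rewrite inE.
rewrite st => hk hl hlt.
have [k' hk' hT] := T_lt hl (tT e0 l hl) hlt.
by rewrite (T_inj hk (ltn_trans hk' hl) (tT e0 k hk) hT).
Qed.

End Trace.

(** * Positions of codes in a word *)

Section CodeStart.
Variables (x : seq isym) (L : seq nat) (off : nat).
Hypothesis hL : drop off x = codes L.
Hypothesis hoff : off <= size x.

Definition code_start i := off + size (codes (take i L)).

Lemma drop_code_start i : drop (code_start i) x = codes (drop i L).
Proof.
rewrite /code_start addnC -drop_drop hL -{2}(cat_take_drop i L) codes_cat.
by rewrite drop_size_cat.
Qed.

Lemma size_codes_off : off + size (codes L) = size x.
Proof. by rewrite -hL size_drop; lia. Qed.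

Lemma code_start_le i : code_start i <= size x.
Proof.
rewrite -size_codes_off /code_start -[in X in _ <= X](cat_take_drop i L).
by rewrite codes_cat size_cat; lia.
Qed.

(** [take] saturates: from index [size L] on, the start is the end of [x]. *)
Lemma code_start_lt i : code_start i < size x -> i < size L.
Proof.
move=> h; rewrite ltnNge; apply/negP => hi; move: h.
by rewrite /code_start take_oversize // size_codes_off ltnn.
Qed.

Lemma code_startS i : i < size L ->
  code_start i.+1 = code_start i + size (enc_nat (nth 0 L i)).
Proof.
move=> hi; rewrite /code_start (take_nth 0) // -cats1 codes_cat size_cat.
by rewrite codes_cons cats0 addnA.
Qed.

End CodeStart.

(** * Reading the word along a trace *)

Section Word.
Variables (x : seq isym) (L : seq nat) (off n m : nat).
Hypothesis hL : drop off x = codes L.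
Hypothesis hoff : off <= size x.
Local Notation at_ p := (nth IHash x p).
Variables (S J : nat -> nat -> Prop) (c : nat -> nat).
Hypothesis S0 : S 0 off.
Hypothesis S_step : forall i s, i < n -> S i s -> exists q,
  [/\ s <= q, at_ q = ISep, forall r, r < q -> s <= r -> at_ r <> ISep & S i.+1 q.+1].
Hypothesis S_end : forall s, S n s -> at_ s = ISep /\ J 0 s.+1.
Hypothesis c_lt : forall k, k < m -> c k < n.
Hypothesis J_step : forall k s p, k < m -> S (c k) s -> J k p ->
  at_ s = ISep /\ J k.+1 p \/
  at_ s <> ISep /\ exists d, [/\ at_ (s + d) = ISep, at_ (p + d) = ISep,
     forall r, r < d -> at_ (s + r) = I0 /\ at_ (p + r) = I0 \/
                        at_ (s + r) = I1 /\ at_ (p + r) = I1 &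
     J k.+1 (p + d).+1].
Hypothesis J_end : forall p, J m p -> p = size x.

Lemma sep_lt p : at_ p = ISep -> p < size x.
Proof. by move=> h; have [] := @split_nth x p ISep (fun h => ltac:(discriminate h)) h. Qed.

Lemma code_at i : i < size L -> drop (code_start L off i) x =
  enc_nat (nth 0 L i) ++ codes (drop i.+1 L).
Proof. by move=> hi; rewrite drop_code_start // (drop_nth 0). Qed.

(** The guessed relation need not be functional: it suffices that it contains the true starts, since
    the conditions hold for all related positions. *)
Lemma start_sound i : i <= n -> S i (code_start L off i).
Proof.
elim: i => [_|i IHi hi]; first by rewrite /code_start take0 addn0.
have [q [hsq hq hr hS]] := S_step hi (IHi (ltnW hi)).
have hiL : i < size L.
  by apply: (code_start_lt hL hoff); apply: leq_ltn_trans hsq (sep_lt hq).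
rewrite code_startS // -(@nth_enc_nat_sep _ (codes (drop i.+1 L)) (q - code_start L off i)).
- by rewrite addnS subnKC.
- move=> r hr'; rewrite -code_at // nth_drop; apply: hr; lia.
- by rewrite -code_at // nth_drop subnKC.
Qed.

Lemma word_code : n < size L /\ nth 0 L n = 0.
Proof.
have [hsep _] := S_end (start_sound (leqnn n)).
have hn : n < size L by apply: (code_start_lt hL hoff); apply: sep_lt.
split=> //; apply/(nth_enc_nat0 _ (codes (drop n.+1 L))).
by rewrite -code_at // nth_drop addn0.
Qed.

Lemma word_sound :
  [seq v <- [seq nth 0 L (c k) | k <- iota 0 m] | v != 0] = drop n.+1 L.
Proof.
have [hnL hn0] := word_code.
(* Invariant: the letters produced by the first [k] events, followed by the list [ws] coded from
   some related position [p], form the whole word. At [k = m] the position is the end of [x], so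
   [ws] is empty. *)
suff inv k : k <= m -> exists p ws, [/\ J k p, drop p x = codes ws &
    [seq v <- [seq nth 0 L (c k) | k <- iota 0 k] | v != 0] ++ ws = drop n.+1 L].
  have [p [ws [/J_end -> hws <-]]] := inv m (leqnn m).
  move: hws; rewrite drop_size; case: ws => [|v ws]; first by rewrite cats0.
  by move=> /(congr1 size); rewrite codes_cons size_cat; have := size_enc_nat_gt0 v; rewrite /=; lia.
elim: k => [_|k IHk hk].
  exists (code_start L off n.+1), (drop n.+1 L); split=> //; last exact: drop_code_start.
  rewrite code_startS // hn0 addn1.
  by have [] := S_end (start_sound (leqnn n)).
have [p [ws [hJ hp hw]]] := IHk (ltnW hk).
have hc := c_lt hk; set v := nth 0 L (c k).
have hcL : c k < size L by apply: ltn_trans hnL.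
have hS := start_sound (ltnW hc).
have atE d : at_ (code_start L off (c k) + d) =
    nth IHash (enc_nat v ++ codes (drop (c k).+1 L)) d.
  by rewrite -code_at // nth_drop.
have -> : iota 0 k.+1 = iota 0 k ++ [:: k] by rewrite -addn1 iotaD.
rewrite map_cat filter_cat /= -/v.
case: (J_step hk hS hJ) => [[hs hJ']|[hs [d [hd1 hd2 hr hJ']]]].
  exists p, ws; split=> //.
  move: hs; rewrite -[code_start _ _ _]addn0 atE => /nth_enc_nat0 ->.
  by rewrite eqxx cats0.
have hv : v <> 0.
  by move=> hv; apply: hs; rewrite -[code_start _ _ _]addn0 atE; apply/nth_enc_nat0.
case: ws hp hw => [|v' ws] hp hw.
  by move: hd2; rewrite -nth_drop hp nth_nil.
have atE' r : at_ (p + r) = nth IHash (enc_nat v' ++ codes ws) r.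
  by rewrite -nth_drop hp.
have sv : d.+1 = size (enc_nat v).
  apply: (@nth_enc_nat_sep _ (codes (drop (c k).+1 L))); rewrite -?atE // => r hr'.
  by rewrite -atE; case: (hr r hr') => -[-> _].
have sv' : d.+1 = size (enc_nat v').
  apply: (@nth_enc_nat_sep _ (codes ws)); rewrite -?atE' // => r hr'.
  by rewrite -atE'; case: (hr r hr') => -[_ ->].
have vv' : v = v'.
  apply: enc_nat_inj; apply: (@eq_from_nth _ IHash); rewrite -sv -?sv' // => r hrd.
  have := atE r; have := atE' r; rewrite !nth_cat -sv -sv' hrd => <- <-.
  have [h|h] := ltnP r d; first by case: (hr r h) => -[-> ->].
  by have -> : r = d by [lia]; rewrite hd1 hd2.
exists (p + d).+1, ws; split=> //.
  by rewrite -addnS addnC -drop_drop hp codes_cons sv' drop_size_cat.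
by move/eqP: hv => ->; rewrite -catA /= vv'.
Qed.

End Word.

Lemma ltn_table i j n : i < n -> j < n -> i * n + j < n * n.
Proof. nia. Qed.

(** * Atoms on [x # y] *)

Section Atoms.
Variables (x y : seq isym).
Local Notation z := (x ++ IHash :: y).
Local Notation X := (size x).
Local Notation at_ p := (nth IHash x p).

Lemma nth_word p : p <= X -> nth I0 z p = at_ p.
Proof.
rewrite leq_eqVlt => /predU1P[->|hp].
  by rewrite nth_cat ltnn subnn [RHS]nth_default.
by rewrite nth_cat hp; apply: set_nth_default.
Qed.

Lemma symP p a : a <> IHash -> p <= X -> p < size z /\ nth I0 z p = a <-> at_ p = a.
Proof.
move=> ha hp; rewrite nth_word // size_cat /=; split=> [[] //|h]; split=> //; lia.
Qed.

Lemma symW p a : a <> IHash -> at_ p = a -> p < size z /\ nth I0 z p = a.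
Proof.
move=> ha h; apply/symP => //; have [hp _] := split_nth ha h; exact: ltnW.
Qed.

(** A run without hash cannot cross position [X]; a comparison of codes that starts in [x] therefore
    never reads the certificate. *)
Lemma run_lt s d : s <= X -> nth I0 z (s + d) <> IHash ->
  (forall r, r < d -> nth I0 z (s + r) <> IHash) -> s + d < X.
Proof.
move=> hs hd hr; rewrite ltnNge; apply/negP => hge.
have hX : nth I0 z (s + (X - s)) = IHash by rewrite subnKC // nth_word // nth_default.
have [h|h] := ltnP (X - s) d; first exact: hr h hX.
by apply: hd; have -> : d = X - s by lia.
Qed.

Definition relb r i j := [&& i < X.+1, j < X.+1, X.+1 < size z,
  (r * X.+1 + i).+1 * X.+1 + j < size z &
  nth I0 z ((r * X.+1 + i).+1 * X.+1 + j) == I1].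

Lemma relP r i j :
  (i < X.+1 /\ X.+1 < size z) /\ (j < X.+1 /\ X.+1 < size z) /\
  (r * X.+1 + i).+1 * X.+1 + j < size z /\
  nth I0 z ((r * X.+1 + i).+1 * X.+1 + j) = I1 <-> relb r i j.
Proof.
split=> [[[h1 h2] [[h3 _] [h4 h5]]] | /and5P[h1 h2 h3 h4 /eqP h5]].
  by rewrite /relb h1 h2 h3 h4 h5 eqxx.
by do !split.
Qed.

End Atoms.

(** * From the truth of the sentence to an instance *)

Section Sound.
Variables (x y : seq isym) (n m : nat).
Local Notation z := (x ++ IHash :: y).
Local Notation X := (size x).
Local Notation at_ p := (nth IHash x p).
Local Notation e := (upd (upd (upd (fun _ => 0) 0 X) 1 n) 2 m).
Local Notation lt_e := (n.+1 + n * n).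
Local Notation cf_e := (lt_e.+1 + n * n).
Hypothesis (hn : n < size z) (hm : m < size z).
Hypothesis hin : sem 3 input_form z e.

Lemma input_sound : cf_e < X /\
  exists L, x = nseq n I1 ++
    ISep :: mkseq (fun u => bit_sym (at_ (n.+1 + u) == I1)) (n * n) ++
    ISep :: mkseq (fun u => bit_sym (at_ (lt_e.+1 + u) == I1)) (n * n) ++
    ISep :: codes L /\ drop cf_e.+1 x = codes L.
Proof.
have sz : size z = X + (size y).+1 by rewrite size_cat.
move: hin; rewrite /= /upd /=.
case=> -[hXz hX] [huniq [[_ hnsep] [hones [hbits [[_ hlte] [[_ hcfe] [hcan [hlast _]]]]]]]].
have neX p a : a <> IHash -> nth I0 z p = a -> p <> X by move=> ha h hp; apply: ha; rewrite -h hp.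
have bits u : u < n * n ->
    (exists2 a, a <> IHash & nth I0 z (n.+1 + u) = a) /\
    (exists2 a, a <> IHash & nth I0 z (lt_e.+1 + u) = a).
  move=> hu; have n0 : 0 < n by nia.
  have hi : u %/ n < n by rewrite ltn_divLR.
  have hj : u %% n < n by rewrite ltn_mod.
  have [h1 h2] := hbits _ (ltn_trans hi hn) (conj hi hn) _ (ltn_trans hj hn) (conj hj hn).
  rewrite -divn_eq in h1 h2; split.
    by case: h1 => -[_ h]; [exists I0 | exists I1].
  by case: h2 => -[_ h]; [exists I0 | exists I1].
(* All positions up to [cf_e] carry a one, a bit or a separator, whereas position [X] carries the
   hash. *)
have hcfX : cf_e < X.
  have [hlt|hge] := ltnP X n.
    by case: (hones X hXz (conj hlt hn)) => _ h; case: (neX _ _ _ h).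
  have nX : X <> n by move=> h; apply: (neX n ISep).
  have [hlt|hge1] := ltnP X lt_e.
    have [|[a ha h] _] := bits (X - n.+1); first lia.
    by case: (neX _ _ ha h); lia.
  have nX1 : X <> lt_e by move=> h; apply: (neX lt_e ISep).
  have [hlt|hge2] := ltnP X cf_e.
    have [|_ [a ha h]] := bits (X - lt_e.+1); first lia.
    by case: (neX _ _ ha h); lia.
  have nX2 : X <> cf_e by move=> h; apply: (neX cf_e ISep).
  lia.
split=> //; apply: input_parse.
- apply/negP => /(nthP IHash)[p hp hpx].
  have hpz : p < size z := ltn_trans hp hXz.
  have [_ h] := huniq p hpz (conj hpz (etrans (nth_word y (ltnW hp)) hpx)).
  by rewrite h ltnn in hp.
- by rewrite -(nth_word y) //; lia.
- move=> i hi; rewrite -(nth_word y); last lia.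
  by have [] := hones i (ltn_trans hi hn) (conj hi hn).
- move=> u hu; have n0 : 0 < n by nia.
  have hi : u %/ n < n by rewrite ltn_divLR.
  have hj : u %% n < n by rewrite ltn_mod.
  have [h1 h2] := hbits _ (ltn_trans hi hn) (conj hi hn) _ (ltn_trans hj hn) (conj hj hn).
  rewrite -divn_eq in h1 h2; rewrite -(nth_word y); last lia.
  by case: h1 => -[_ ->]; [left | right].
- by rewrite -(nth_word y) //; lia.
- move=> u hu; have n0 : 0 < n by nia.
  have hi : u %/ n < n by rewrite ltn_divLR.
  have hj : u %% n < n by rewrite ltn_mod.
  have [h1 h2] := hbits _ (ltn_trans hi hn) (conj hi hn) _ (ltn_trans hj hn) (conj hj hn).
  rewrite -divn_eq in h1 h2; rewrite -(nth_word y); last lia.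
  by case: h2 => -[_ ->]; [left | right].
- by rewrite -(nth_word y) //; lia.
- move=> p hp h0 h1.
  have [hpX _] := split_nth (fun h : I0 = IHash => ltac:(discriminate h)) h0.
  have hpz : p < size z by lia.
  apply: (hcan p hpz (conj hpX hXz) (conj hp hpz)); first exact: symW.
  exact: symW.
move=> p hp; rewrite -(nth_word y); last lia.
have hpz : p.+1 < size z by lia.
have hpX : p < X by lia.
by have [] := hlast p (ltnW hpz) (conj hpX hXz) (conj hpz hp).
Qed.

Hypothesis hev : sem 3 event_form z e.
Hypothesis hst : sem 3 start_form z e.
Hypothesis htr : sem 3 trace_form z e.
Hypothesis hwd : sem 3 word_form z e.

Local Notation ltb i j := (at_ (n.+1 + (i * n + j)) == I1).
Local Notation cfb i j := (at_ (lt_e.+1 + (i * n + j)) == I1).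
Local Notation relz := (relb x y).

Lemma ltbP i j : i < n -> j < n ->
  n.+1 + (i * n + j) < size z /\ nth I0 z (n.+1 + (i * n + j)) = I1 <-> ltb i j.
Proof.
move=> hi hj; have [hX _] := input_sound; have := ltn_table hi hj => ht.
by rewrite symP //; [split=> [->|/eqP] | lia].
Qed.

Lemma cfbP i j : i < n -> j < n ->
  lt_e.+1 + (i * n + j) < size z /\ nth I0 z (lt_e.+1 + (i * n + j)) = I1 <-> cfb i j.
Proof.
move=> hi hj; have [hX _] := input_sound; have := ltn_table hi hj => ht.
by rewrite symP //; [split=> [->|/eqP] | lia].
Qed.

Lemma start_sound_form :
  [/\ relz 1 0 cf_e.+1,
     forall i s, i < n -> relz 1 i s -> exists q,
       [/\ s <= q, at_ q = ISep, forall r, r < q -> s <= r -> at_ r <> ISep &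
           relz 1 i.+1 q.+1] &
     forall s, relz 1 n s -> at_ s = ISep /\ relz 2 0 s.+1].
Proof.
move: hst; rewrite /= /upd /=; case=> /relP h0 [hs [hend _]]; split=> //.
  move=> i s hi /relP hR; have hsX : s < X.+1 /\ X.+1 < size z by tauto.
  have [q hq [[hqX _] [[hsq _] [hqs [hr [/relP hR' _]]]]]] :=
    hs i (ltn_trans hi hn) (conj hi hn) s (leq_trans hsX.1 (ltnW hsX.2)) hR.
  exists q; split=> //; first by apply/(symP y) => //; exact: ltnW.
  move=> r hrq hsr hrs; apply: (hr r _ _ _ (symW _ _ hrs)) => //; lia.
move=> s /relP hR; have hsX : s < X.+1 /\ X.+1 < size z by tauto.
have [hsep /relP hJ] := hend s (leq_trans hsX.1 (ltnW hsX.2)) hR.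
by split=> //; apply/(symP y) => //; exact: hsX.1.
Qed.

Lemma word_sound_form :
  (forall k i s p, k < m -> i < n -> relz 0 k i -> relz 1 i s -> relz 2 k p ->
    at_ s = ISep /\ relz 2 k.+1 p \/
    at_ s <> ISep /\ exists d, [/\ at_ (s + d) = ISep, at_ (p + d) = ISep,
       forall r, r < d -> at_ (s + r) = I0 /\ at_ (p + r) = I0 \/
                          at_ (s + r) = I1 /\ at_ (p + r) = I1 &
       relz 2 k.+1 (p + d).+1]) /\
  (forall p, relz 2 m p -> p = X).
Proof.
move: hwd; rewrite /= /upd /=; case=> hw [hend _]; split; last first.
  move=> p /relP hR; have hpX : p < X.+1 /\ X.+1 < size z by tauto.
  by have [] := hend p (leq_trans hpX.1 (ltnW hpX.2)) hR.
move=> k i s p hk hi /relP hT /relP hS /relP hJ.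
have hsX : s < X.+1 /\ X.+1 < size z by tauto.
have hpX : p < X.+1 /\ X.+1 < size z by tauto.
have := hw k (ltn_trans hk hm) (conj hk hm) i (ltn_trans hi hn) (conj hi hn)
  s (leq_trans hsX.1 (ltnW hsX.2)) p (leq_trans hpX.1 (ltnW hpX.2)) hT hS hJ.
case=> [[hs /relP hJ'] | [hs [d hd [[hdX _] [hsd [hpd [hr [/relP hJ' _]]]]]]]].
  by left; split=> //; apply/(symP y) => //; exact: hsX.1.
right; split.
  by move=> h; apply: hs; apply/symP => //; exact: hsX.1.
have run t : t <= X -> t + d < size z /\ nth I0 z (t + d) = ISep ->
    (forall r, r < d -> is_bit (nth I0 z (t + r))) -> t + d < X.
  move=> ht [_ h] hb; apply: (@run_lt x y) => [//||r /hb[] -> //].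
  by rewrite h.
have bits r : r < d -> nth I0 z (s + r) = I0 /\ nth I0 z (p + r) = I0 \/
                       nth I0 z (s + r) = I1 /\ nth I0 z (p + r) = I1.
  move=> hrd; have := hr r (ltn_trans hrd hd) (conj hrd hd).
  by case=> -[[_ ->] [_ ->]]; [left | right].
have hs' : s + d < X.
  by apply: run; [exact: hsX.1 | | move=> r /bits[] [-> _]; [left | right]].
have hp' : p + d < X.
  by apply: run; [exact: hpX.1 | | move=> r /bits[] [_ ->]; [left | right]].
exists d; split=> //; try by apply/(symP y) => //; exact: ltnW.
move=> r hrd; rewrite -!(nth_word y); try lia.
exact: bits.
Qed.

Lemma trace_sound_form :
  [/\ forall k, k < m -> exists2 i, i < n & relz 0 k i,
      forall k i j, k < m -> i < n -> j < n -> relz 0 k i -> relz 0 k j -> i = j,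
      forall k l i, k < m -> l < m -> i < n -> relz 0 k i -> relz 0 l i -> k = l,
      forall k i j, k < m -> i < n -> j < n -> relz 0 k i -> ltb j i ->
        exists2 l, l < k & relz 0 l j &
      (forall k l i j, k < m -> l < m -> i < n -> j < n -> relz 0 k i ->
         relz 0 l j -> ~~ cfb i j) /\
      forall a, a < n -> (exists2 k, k < m & relz 0 k a) \/
        exists2 b, b < n & (ltb b a /\ forall k, k < m -> ~ relz 0 k b) \/
             (cfb a b /\ exists2 k, k < m & relz 0 k b)].
Proof.
move: htr; rewrite /= /upd /=; case=> h1 [h2 [h3 [h4 [h5 [h6 _]]]]].
have nz i : i < n -> i < size z by move=> hi; apply: ltn_trans hn.
have mz i : i < m -> i < size z by move=> hi; apply: ltn_trans hm.
split.
- move=> k hk; have [i _ [[hi _] /relP hR]] := h1 k (mz k hk) (conj hk hm).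
  by exists i.
- move=> k i j hk hi hj /relP hR /relP hR'.
  by have [] := h2 k (mz k hk) (conj hk hm) i (nz i hi) (conj hi hn) j (nz j hj) (conj hj hn) hR hR'.
- move=> k l i hk hl hi /relP hR /relP hR'.
  by have [] := h3 k (mz k hk) (conj hk hm) l (mz l hl) (conj hl hm) i (nz i hi) (conj hi hn) hR hR'.
- move=> k i j hk hi hj /relP hR /(ltbP hj hi) hlt.
  have [l _ [[hl _] /relP hR']] :=
    h4 k (mz k hk) (conj hk hm) i (nz i hi) (conj hi hn) j (nz j hj) (conj hj hn) hR hlt.
  by exists l.
split.
  move=> k l i j hk hl hi hj /relP hR /relP hR'; apply/negP => /(cfbP hi hj) hcf.
  exact: (h5 k (mz k hk) (conj hk hm) l (mz l hl) (conj hl hm)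
    i (nz i hi) (conj hi hn) j (nz j hj) (conj hj hn) hR hR' hcf).
move=> a ha; case: (h6 a (nz a ha) (conj ha hn)) => [[k _ [[hk _] /relP hR]]|].
  by left; exists k.
case=> b _ [[hb _] [[/(ltbP hb ha) hlt hno]|[/(cfbP ha hb) hcf [k _ [[hk _] /relP hR]]]]];
  right; exists b => //; [left | right; split=> //; by exists k].
by split=> // k hk /relP hR; apply: hno hR; first exact: mz.
Qed.

Lemma event_sound_form :
  [/\ forall i, i < n -> ~~ ltb i i /\ ~~ cfb i i,
      forall i j, i < n -> j < n -> cfb i j -> cfb j i,
      forall i j k, i < n -> j < n -> k < n -> ltb j k ->
        (ltb i j -> ltb i k) /\ (cfb i j -> cfb i k) &
      exists2 b, b < n & (forall a, a < n -> ~~ ltb a b /\ (a = b \/ ltb b a)) /\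
        forall s, relz 1 b s -> at_ s = ISep].
Proof.
move: hev; rewrite /= /upd /=; case=> h1 [h2 [h3 [[b _ [[hb _] [h4 h5]]] _]]].
have nz i : i < n -> i < size z by move=> hi; apply: ltn_trans hn.
split.
- move=> i hi; have [ha hc] := h1 i (nz i hi) (conj hi hn).
  by split; apply/negP; [move/(ltbP hi hi) | move/(cfbP hi hi)].
- move=> i j hi hj /(cfbP hi hj) h; apply/(cfbP hj hi).
  exact: (h2 i (nz i hi) (conj hi hn) j (nz j hj) (conj hj hn) h).
- move=> i j k hi hj hk /(ltbP hj hk) h.
  have [ha hc] := h3 i (nz i hi) (conj hi hn) j (nz j hj) (conj hj hn) k (nz k hk) (conj hk hn) h.
  split=> [/(ltbP hi hj) /ha|/(cfbP hi hj) /hc] h'; first exact/(ltbP hi hk).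
  exact/(cfbP hi hk).
exists b => //; split=> [a ha | s /relP hR].
  have [hno hor] := h4 a (nz a ha) (conj ha hn); split.
    by apply/negP => /(ltbP ha hb).
  by case: hor => [[_ ->]|/(ltbP hb ha) hab]; [left | right].
have hsX : s < X.+1 /\ X.+1 < size z by tauto.
apply/(symP y) => //; first exact: hsX.1.
by apply: h5 => //; apply: leq_trans hsX.1 (ltnW hsX.2).
Qed.

Lemma membership_sound : FLES_MEMBERSHIP x.
Proof.
have [hX [L [hx hL]]] := input_sound.
have [S0 S_step S_end] := start_sound_form.
have [J_step J_end] := word_sound_form.
have [T_ex T_fun T_inj T_lt [T_cf T_max]] := trace_sound_form.
have [irr cf_sym tr [b hb [hbot hlab]]] := event_sound_form.
pose E := @FLES n (fun i j : 'I_n => ltb i j) (fun i j : 'I_n => cfb i j)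
  (fun i : 'I_n => nth 0 L i).
pose bot : 'I_n := Ordinal hb.
have word := @word_sound x L cf_e.+1 n m hL hX (relz 1) (relz 2).
have start := @start_sound x L cf_e.+1 n hL hX (relz 1) S0 S_step.
have [hnL hn0] := @word_code x L cf_e.+1 n hL hX (relz 1) (relz 2) S0 S_step S_end.
have hE : is_fles E.
  split.
  - split=> [i | i j k]; first by have [] := irr i (ltn_ord i).
    move=> h1 h2.
    by have [h _] := tr _ _ _ (ltn_ord i) (ltn_ord j) (ltn_ord k) h2; apply: h.
  - by move=> i; have [] := irr i (ltn_ord i).
  - by move=> i j; apply: cf_sym.
  - move=> i j k h1 h2.
    by have [_ h] := tr _ _ _ (ltn_ord i) (ltn_ord j) (ltn_ord k) h2; apply: h.
  exists bot; split=> [a | a ha |].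
  - by have [] := hbot a (ltn_ord a).
  - have [_ []//] := hbot a (ltn_ord a).
    by move=> h; case/eqP: ha; apply: val_inj.
  apply/(nth_enc_nat0 _ (codes (drop b.+1 L))).
  rewrite -(code_at hL); last exact: ltn_trans hnL.
  by rewrite nth_drop addn0; apply: hlab; apply: start; apply: ltnW.
have [C [t [hC ht st tT]]] : exists C t, [/\ is_max_config E C, is_trace E C t, size t = m &
      forall e0 k, k < m -> relz 0 k (nth e0 t k)].
  apply: (@trace_sound E hE m (fun k i => relz 0 k i)).
  - by move=> k hk; have [i hi hT] := T_ex k hk; exists (Ordinal hi).
  - move=> k i j hk h1 h2; apply: val_inj.
    exact: T_fun hk (ltn_ord i) (ltn_ord j) h1 h2.
  - by move=> k l i hk hl; apply: T_inj.
  - by move=> k i j hk; apply: T_lt.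
  - by move=> k l i j hk hl; apply: T_cf.
  move=> a; case: (T_max a (ltn_ord a)) => [|[a' ha' h]]; first by left.
  by right; exists (Ordinal ha').
exists E, (drop n.+1 L); split; last split=> //; last first.
  have lab_t : [seq nth 0 L (nth bot t k) | k <- iota 0 m] = map (evlab E) t.
    by rewrite -{2}(mkseq_nth bot t) st /mkseq -map_comp.
  exists C, t; split=> //.
  rewrite -(@word (fun k => nth bot t k)) //.
  - by rewrite lab_t filter_map.
  - by move=> k s p hk hs hJ; apply: J_step hs hJ => //; apply: tT.
rewrite hx /enc_inst /enc_fles.
rewrite (enc_relE (r' := fun i j => ltb i j)) // (enc_relE (r' := fun i j => cfb i j)) //.
rewrite -!catA /= -!catA /= -!catA /=; congr (_ ++ _ :: _ ++ _ :: _ ++ _ :: _).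
- by apply: eq_mkseq => u; rewrite -divn_eq.
- by apply: eq_mkseq => u; rewrite -divn_eq.
rewrite -[in LHS](cat_take_drop n L) codes_cat (drop_nth 0) // hn0 codes_cons.
congr (_ ++ _); rewrite -(@map_nth_iota0 _ 0 L n (ltnW hnL)) -val_enum_ord /codes.
by rewrite -!map_comp.
Qed.

End Sound.

(** * Completeness *)

Section Table.
Variables (x : seq isym) (rel3 : nat -> nat -> nat -> bool).
Local Notation D := (size x).+1.

Definition table : seq isym :=
  mkseq (fun u => bit_sym (rel3 (u %/ D %/ D) (u %/ D %% D) (u %% D))) (3 * D * D).

Lemma size_word_table : size (x ++ IHash :: table) = D + 3 * D * D.
Proof. by rewrite size_cat -[size (_ :: _)]/(size table).+1 size_mkseq addnS. Qed.

Lemma relb_table r i j : r < 3 ->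
  (rel3 r i j -> i < D /\ j < D) -> relb x table r i j = rel3 r i j.
Proof.
move=> hr hrel; case hij : ((i < D) && (j < D)); last first.
  case hR : (rel3 r i j); first by have [h1 h2] := hrel hR; rewrite h1 h2 in hij.
  by apply/negbTE; apply: contraFN hij => /and5P[-> ->].
have /andP[hi hj] := hij; rewrite /relb hi hj size_word_table.
have hb : (r * D + i) * D + j < 3 * D * D by nia.
have -> : D < D + 3 * D * D by nia.
have -> : (r * D + i).+1 * D + j < D + 3 * D * D by nia.
rewrite nth_cat ifF; last by nia.
have -> : (r * D + i).+1 * D + j - size x = ((r * D + i) * D + j).+1 by nia.
have divD a b : b < D -> (a * D + b) %/ D = a.
  by move=> hb'; rewrite divnMDl // divn_small // addn0.
have modD a b : b < D -> (a * D + b) %% D = b.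
  by move=> hb'; rewrite modnMDl modn_small.
rewrite -[nth _ (_ :: _) _]/(nth _ table _) nth_mkseq // !divD // !modD //.
by case: rel3.
Qed.

Lemma table_nohash : IHash \notin table.
Proof. by apply/negP => /mapP[u _]; case: rel3. Qed.

End Table.

(** * Truth of the sentence on an instance *)

Section Complete.
Variables (E : fles) (w : seq nat).
Hypothesis hE : is_fles E.
Variables (C : {set 'I_(nev E)}) (t : seq 'I_(nev E)).
Hypothesis (hC : is_max_config E C) (ht : is_trace E C t) (hw : hword E t = w).

Local Notation n := (nev E).
Local Notation x := (enc_inst E w).
Local Notation X := (size x).
Local Notation m := (size t).
Local Notation lt_e := (n.+1 + n * n).
Local Notation cf_e := (lt_e.+1 + n * n).
Local Notation at_ p := (nth IHash x p).

Definition labels : seq nat := [seq evlab E i | i <- enum 'I_n] ++ 0 :: w.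
Local Notation L := labels.
Local Notation start i := (code_start L cf_e.+1 i).

Lemma size_labels : size L = n.+1 + size w.
Proof. by rewrite size_cat size_map size_enum_ord /= addnS. Qed.

Lemma enc_instE : x = nseq n I1 ++
    ISep :: mkseq (fun u => bit_sym (ord_rel (evlt E) (u %/ n) (u %% n))) (n * n) ++
    ISep :: mkseq (fun u => bit_sym (ord_rel (evcf E) (u %/ n) (u %% n))) (n * n) ++
    ISep :: codes L.
Proof.
rewrite /enc_inst /enc_fles (enc_relE (r' := ord_rel (evlt E))); last first.
  by move=> a b; rewrite ord_relE.
rewrite (enc_relE (r' := ord_rel (evcf E))); last by move=> a b; rewrite ord_relE.
rewrite /L codes_cat codes_cons /codes -map_comp.
by rewrite -!catA /= -!catA /= -!catA.
Qed.

Lemma at_lt u : u < n * n ->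
  at_ (n.+1 + u) = bit_sym (ord_rel (evlt E) (u %/ n) (u %% n)).
Proof.
move=> hu; rewrite enc_instE nth_cat size_nseq ifF; last lia.
have -> : n.+1 + u - n = u.+1 by lia.
by rewrite /= nth_cat size_mkseq hu nth_mkseq.
Qed.

Lemma at_cf u : u < n * n ->
  at_ (lt_e.+1 + u) = bit_sym (ord_rel (evcf E) (u %/ n) (u %% n)).
Proof.
move=> hu; rewrite enc_instE nth_cat size_nseq ifF; last lia.
have -> : lt_e.+1 + u - n = (n * n + u.+1).+1 by lia.
rewrite /= nth_cat size_mkseq ifF; last lia.
by rewrite addKn /= nth_cat size_mkseq hu nth_mkseq.
Qed.

Lemma at_one i : i < n -> at_ i = I1.
Proof. by move=> hi; rewrite enc_instE nth_cat size_nseq hi nth_nseq hi. Qed.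

Lemma at_n : at_ n = ISep.
Proof. by rewrite enc_instE nth_cat size_nseq ltnn subnn. Qed.

Lemma at_lt_end : at_ lt_e = ISep.
Proof.
rewrite enc_instE nth_cat size_nseq ifF; last lia.
have -> : lt_e - n = (n * n).+1 by lia.
by rewrite /= nth_cat size_mkseq ltnn subnn.
Qed.

Lemma drop_cf : drop cf_e.+1 x = codes L.
Proof.
rewrite enc_instE drop_cat size_nseq ifF; last lia.
have -> : cf_e.+1 - n = (n * n + (n * n).+1.+1).+1 by lia.
rewrite /= drop_cat size_mkseq ifF; last lia.
rewrite addKn /= drop_cat size_mkseq ifF; last lia.
by rewrite subSnn /= drop0.
Qed.

Lemma at_cf_end : at_ cf_e = ISep.
Proof.
rewrite enc_instE nth_cat size_nseq ifF; last lia.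
have -> : cf_e - n = (n * n + (n * n).+1).+1 by lia.
rewrite /= nth_cat size_mkseq ifF; last lia.
by rewrite addKn /= nth_cat size_mkseq ltnn subnn.
Qed.

Lemma cf_end_lt : cf_e < X.
Proof. by have [] := @split_nth x cf_e ISep (fun h => ltac:(discriminate h)) at_cf_end. Qed.

Lemma nohash_inst : IHash \notin x.
Proof.
rewrite enc_instE; do 3 rewrite mem_cat in_cons /= negb_or.
rewrite codes_nohash andbT mem_nseq andbF /=.
by apply/andP; split; apply/negP => /mapP[u _]; case: ord_rel.
Qed.

Lemma trace_size : m <= n.
Proof.
have [u _ _] := ht; rewrite -[X in _ <= X]card_ord.
by rewrite -(card_uniqP u); apply: max_card.
Qed.

Lemma size_gt : n.+1 < X.
Proof. by have := cf_end_lt; lia. Qed.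

(** Intended values of [fTrace], [fStart] and [fWord]. In the last one [n.+1] skips the labels and
    the separating 0, and the word produced so far gives the number of letters consumed. Positions
    go up to [X] included, reached when the word is exhausted. *)
Definition pos_rel (r i j : nat) : bool :=
  match r with
  | 0 => (i < m) && (nth n (map val t) i == j)
  | 1 => (i <= n) && (j == start i)
  | _ => (i <= m) && (j == start (n.+1 + size (hword E (take i t))))
  end.

Local Notation y := (table x pos_rel).
Local Notation z := (x ++ IHash :: y).
Local Notation e := (upd (upd (upd (fun _ => 0) 0 X) 1 n) 2 m).

Lemma relE r i j : r < 3 -> relb x y r i j = pos_rel r i j.
Proof.
move=> hr; apply: relb_table => //; have := trace_size; have := size_gt.
case: r hr => [|[|r]] hr h1 h2 /andP[hi /eqP hj].
- have : nth n (map val t) i \in map val t by rewrite mem_nth ?size_map.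
  by rewrite hj => /mapP[a _ ha]; have := ltn_ord a; rewrite ha /=; split; lia.
- split; [lia | rewrite hj ltnS].
  exact: code_start_le drop_cf cf_end_lt _.
- split; [lia | rewrite hj ltnS].
  exact: code_start_le drop_cf cf_end_lt _.
Qed.

Lemma size_z : X.+1 < size z.
Proof. by rewrite size_word_table; lia. Qed.

Lemma n_lt : n < size z.
Proof. by have := size_z; have := size_gt; lia. Qed.

Lemma m_lt : m < size z.
Proof. by apply: leq_ltn_trans trace_size n_lt. Qed.

Lemma codes_at p : cf_e < p -> at_ p = nth IHash (codes L) (p - cf_e.+1).
Proof. by move=> hp; rewrite -drop_cf nth_drop subnKC. Qed.

Lemma input_complete : sem 3 input_form z e.
Proof.
have hz := size_z; have hcfX := cf_end_lt; have hXz : X < size z by lia.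
have hcfz : cf_e < size z by lia.
have [hsort hlast] := codes_canonical L.
rewrite /= /upd /=.
refine (conj _ (conj _ (conj _ (conj _ (conj _ (conj _ (conj _ (conj _ (conj _ _))))))))).
- by rewrite nth_word // nth_default.
- move=> p _ [hp hpz]; split=> //; move: hpz; rewrite nth_cat.
  case: ltnP => h1 h2; last first.
    case: (posnP (p - X)) h2 => [h _|h]; first lia.
    rewrite -(prednK h) /= => h2.
    have /negP[] := table_nohash x pos_rel; rewrite -h2; apply: mem_nth.
    by move: hp; rewrite size_cat /=; lia.
  by case/negP: nohash_inst; rewrite -h2 mem_nth.
- exact: symW at_n.
- by move=> i _ [hi _]; apply: symW => //; apply: at_one.
- move=> i _ [hi _] j _ [hj _]; have hu := ltn_table hi hj; split.
    have := at_lt hu; case: ord_rel => /= h; [right | left]; exact: symW h.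
  by have := at_cf hu; case: ord_rel => /= h; [right | left]; apply: symW h.
- exact: symW at_lt_end.
- exact: symW at_cf_end.
- move=> p _ [hpX _] [hcp _] [_ h0] [_ h1]; move: h0 h1.
  rewrite !nth_word //; last exact: ltnW.
  rewrite codes_at // codes_at; last lia.
  rewrite subSn; last lia.
  move=> h0 h1; have hi : (p - cf_e.+1).+1 < size (codes L).
    by have [] := @split_nth (codes L) _ ISep (fun h => ltac:(discriminate h)) h1.
  by have /(sortedP IHash)/(_ _ hi) := hsort; rewrite /canonical_adj h0 h1.
- move=> p _ _ [_ hp]; apply: symW => //.
  have hs := size_codes_off drop_cf cf_end_lt.
  have hs0 : 0 < size (codes L).
    rewrite /labels codes_cat codes_cons [size (_ ++ _)]size_cat [size (_ ++ codes w)]size_cat.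
    by have := size_enc_nat_gt0 0; lia.
  rewrite codes_at; last lia.
  move: hlast; rewrite (last_nth IHash) -(prednK hs0) /=.
  by have -> : (size (codes L)).-1 = p - cf_e.+1 by lia.
by split; lia.
Qed.

Lemma ltb_ord (a b : 'I_n) : (at_ (n.+1 + (a * n + b)) == I1) = evlt E a b.
Proof.
rewrite at_lt; last exact: ltn_table.
have n0 : 0 < n by apply: leq_ltn_trans (ltn_ord a).
rewrite divnMDl // divn_small // addn0 modnMDl modn_small // ord_relE.
by case: evlt.
Qed.

Lemma cfb_ord (a b : 'I_n) : (at_ (lt_e.+1 + (a * n + b)) == I1) = evcf E a b.
Proof.
rewrite at_cf; last exact: ltn_table.
have n0 : 0 < n by apply: leq_ltn_trans (ltn_ord a).
rewrite divnMDl // divn_small // addn0 modnMDl modn_small // ord_relE.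
by case: evcf.
Qed.

Lemma ltP_ord (a b : 'I_n) :
  n.+1 + (a * n + b) < size z /\ nth I0 z (n.+1 + (a * n + b)) = I1 <-> evlt E a b.
Proof.
rewrite -ltb_ord; exact: (ltbP n_lt m_lt input_complete (ltn_ord a) (ltn_ord b)).
Qed.

Lemma cfP_ord (a b : 'I_n) :
  lt_e.+1 + (a * n + b) < size z /\ nth I0 z (lt_e.+1 + (a * n + b)) = I1 <-> evcf E a b.
Proof.
rewrite -cfb_ord; exact: (cfbP n_lt m_lt input_complete (ltn_ord a) (ltn_ord b)).
Qed.

Lemma atomP r i j : r < 3 ->
  (i < X.+1 /\ X.+1 < size z) /\ (j < X.+1 /\ X.+1 < size z) /\
  (r * X.+1 + i).+1 * X.+1 + j < size z /\
  nth I0 z ((r * X.+1 + i).+1 * X.+1 + j) = I1 <-> pos_rel r i j.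
Proof. by move=> hr; rewrite relP relE. Qed.

Lemma nth_labels (a : 'I_n) : nth 0 L a = evlab E a.
Proof.
rewrite nth_cat size_map size_enum_ord ltn_ord (nth_map a) ?size_enum_ord //.
by rewrite nth_ord_enum.
Qed.

Lemma nth_labels_word j : nth 0 L (n.+1 + j) = nth 0 w j.
Proof.
rewrite nth_cat size_map size_enum_ord ifF; last lia.
by have -> : n.+1 + j - n = j.+1 by lia.
Qed.

Lemma nth_labels_n : nth 0 L n = 0.
Proof. by rewrite nth_cat size_map size_enum_ord ltnn subnn. Qed.

Lemma at_start i d : i < size L ->
  at_ (start i + d) = nth IHash (enc_nat (nth 0 L i) ++ codes (drop i.+1 L)) d.
Proof. by move=> hi; rewrite -nth_drop (code_at drop_cf). Qed.

Lemma event_complete : sem 3 event_form z e.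
Proof.
case: hE => [[lt_irr lt_tr] cf_irr cf_sym cf_lt [bot [hbot hbot' hlab]]].
rewrite /= /upd /=; refine (conj _ (conj _ (conj _ (conj _ _)))).
- move=> i _ [hi _]; split; first by move=> /(ltP_ord (Ordinal hi) (Ordinal hi)); apply/negP.
  by move=> /(cfP_ord (Ordinal hi) (Ordinal hi)); apply/negP.
- move=> i _ [hi _] j _ [hj _] /(cfP_ord (Ordinal hi) (Ordinal hj)) h.
  exact/(cfP_ord (Ordinal hj) (Ordinal hi))/cf_sym.
- move=> i _ [hi _] j _ [hj _] k _ [hk _] /(ltP_ord (Ordinal hj) (Ordinal hk)) h; split.
    move=> /(ltP_ord (Ordinal hi) (Ordinal hj)) h'.
    by apply/(ltP_ord (Ordinal hi) (Ordinal hk)); apply: lt_tr h' h.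
  move=> /(cfP_ord (Ordinal hi) (Ordinal hj)) h'.
  by apply/(cfP_ord (Ordinal hi) (Ordinal hk)); apply: cf_lt h' h.
- exists (val bot); first exact: ltn_trans (ltn_ord bot) n_lt.
  split; first by split; [exact: ltn_ord | exact: n_lt].
  split.
    move=> a _ [ha _]; split.
      by move=> /(ltP_ord (Ordinal ha) bot); apply/negP.
    have [<-|hab] := eqVneq (Ordinal ha) bot; first by left; split=> //; apply: ltn_trans ha n_lt.
    by right; apply/(ltP_ord bot (Ordinal ha))/hbot'.
  move=> s _ /(@atomP 1) -/(_ isT) /andP[_ /eqP ->]; apply: symW => //.
  rewrite -[code_start _ _ _]addn0 at_start; last by rewrite size_labels; apply/ltn_addr/leqW/ltn_ord.
  by apply/nth_enc_nat0; rewrite nth_labels.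
by split=> //; apply: leq_ltn_trans n_lt.
Qed.

Lemma start_complete : sem 3 start_form z e.
Proof.
have hz := size_z; have hcfX := cf_end_lt; have hXz : X < size z by lia.
have z0 : 0 < size z by lia.
rewrite /= /upd /=; refine (conj _ (conj _ (conj _ _))) => //.
- by apply/(@atomP 1) => //=; rewrite /code_start take0 addn0.
- move=> i _ [hi _] s _ /(@atomP 1) -/(_ isT) /andP[_ /eqP ->].
  have hiL : i < size L by rewrite size_labels; lia.
  have hS := code_startS cf_e.+1 hiL.
  have h0 := size_enc_nat_gt0 (nth 0 L i).
  have hle := code_start_le drop_cf hcfX i.+1.
  have hq : start i.+1 = (start i + (size (enc_nat (nth 0 L i))).-1).+1 by lia.
  exists (start i + (size (enc_nat (nth 0 L i))).-1); first lia.
  refine (conj _ (conj _ (conj _ (conj _ (conj _ _))))); try by split; lia.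
  + by apply: symW => //; rewrite at_start // nth_enc_nat_last.
  + move=> r hrz [hr _] [hsr _]; rewrite symP //; last lia.
    rewrite -[r](@subnKC (start i)); last lia.
    rewrite at_start // => h.
    by have [] := @nth_enc_nat_lt (nth 0 L i) (codes (drop i.+1 L)) (r - start i);
      [lia | rewrite h..].
  by apply/(@atomP 1) => //=; rewrite -hq hi eqxx.
move=> s _ /(@atomP 1) -/(_ isT) /andP[_ /eqP ->].
have hnL : n < size L by rewrite size_labels; lia.
split.
  apply: symW => //; rewrite -[code_start _ _ _]addn0 at_start //.
  by apply/nth_enc_nat0; rewrite nth_labels_n.
apply/(@atomP 2) => //=; rewrite take0 addn0 code_startS // nth_labels_n.
by rewrite addn1.
Qed.

Lemma traceP k (a : 'I_n) : pos_rel 0 k a <-> a \in t /\ index a t = k.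
Proof.
have [t_uniq _ _] := ht; split=> /= [/andP[hk]|[hat <-]].
  rewrite (nth_map a) // => /eqP /val_inj <-; split; first exact: mem_nth.
  exact: index_uniq.
have hi : index a t < m by rewrite index_mem.
by rewrite hi (nth_map a) // nth_index // eqxx.
Qed.

Lemma trace_relP k (a : 'I_n) :
  (k < X.+1 /\ X.+1 < size z) /\ (a < X.+1 /\ X.+1 < size z) /\
  (0 * X.+1 + k).+1 * X.+1 + a < size z /\
  nth I0 z ((0 * X.+1 + k).+1 * X.+1 + a) = I1 <-> a \in t /\ index a t = k.
Proof. by rewrite atomP // traceP. Qed.

(** Otherwise [a |: C] would be left closed and conflict free, against the maximality of [C]. *)
Lemma max_config_ext (a : 'I_n) : a \notin t ->
  (exists2 b, evlt E b a & b \notin t) \/ (exists2 b, evcf E a b & b \in t).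
Proof.
case: hE => [[lt_irr lt_tr] cf_irr cf_sym cf_lt _] hat.
have [[lcC cfC] maxC] := hC; have [_ memC _] := ht.
case: (boolP [exists b, evlt E b a && (b \notin t)]) => [/existsP[b /andP[h1 h2]]|].
  by left; exists b.
move=> /existsPn hlt; case: (boolP [exists b, evcf E a b && (b \in t)]).
  by move=> /existsP[b /andP[h1 h2]]; right; exists b.
move=> /existsPn hcf; case/negP: hat; rewrite memC.
rewrite -(maxC (a |: C)); [exact: setU11 | | exact: subsetUr].
have hcf' b : b \in C -> ~~ evcf E a b.
  by rewrite -memC => hb; have := hcf b; rewrite hb andbT.
split=> [b b'|b b']; rewrite !in_setU1.
  move=> /predU1P[-> hl|hb hl]; last by rewrite (lcC _ _ hb hl) orbT.
  by have := hlt b'; rewrite hl /= negbK memC => ->; rewrite orbT.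
move=> /predU1P[->|hb] /predU1P[->|hb'] //; [exact: hcf' | | exact: cfC].
by apply/negP => /cf_sym; apply/negP/hcf'.
Qed.

Lemma trace_complete : sem 3 trace_form z e.
Proof.
have [[lcC cfC] _] := hC; have [t_uniq memC t_ord] := ht.
have z0 : 0 < size z by apply: leq_ltn_trans m_lt.
have nz i : i < n -> i < size z by move=> hi; apply: ltn_trans n_lt.
have mz i : i < m -> i < size z by move=> hi; apply: ltn_trans m_lt.
rewrite /= /upd /=.
refine (conj _ (conj _ (conj _ (conj _ (conj _ (conj _ _)))))) => //.
- move=> k _ [hk _]; have [_ _ _ _ [bot _]] := hE.
  exists (val (nth bot t k)); first exact/nz/ltn_ord.
  split; first by split; [exact: ltn_ord | exact: n_lt].
  by apply/trace_relP; rewrite mem_nth // index_uniq.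
- move=> k _ [hk _] i hiz [hi _] j _ [hj _].
  move=> /(trace_relP k (Ordinal hi)) [h1 h2] /(trace_relP k (Ordinal hj)) [h3 h4].
  split=> //; have [_ _ _ _ [bot _]] := hE.
  suff : Ordinal hi = Ordinal hj by case.
  by rewrite -(nth_index bot h1) h2 -h4 nth_index.
- move=> k hkz [hk _] l _ [hl _] i _ [hi _].
  move=> /(trace_relP k (Ordinal hi)) [h1 h2] /(trace_relP l (Ordinal hi)) [h3 h4].
  by split=> //; rewrite -h2 -h4.
- move=> k hkz [hk _] i hiz [hi _] j _ [hj _].
  move=> /(trace_relP k (Ordinal hi)) [h1 h2] /(ltP_ord (Ordinal hj) (Ordinal hi)) hlt.
  have hjt : Ordinal hj \in t by rewrite memC; apply: lcC hlt; rewrite -memC.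
  have hjk : index (Ordinal hj) t < k.
    rewrite -h2; apply: (t_ord (Ordinal hj)); rewrite ?index_mem // !nth_index //.
  exists (index (Ordinal hj) t); first exact: ltn_trans hkz.
  by split=> //; apply/(trace_relP _ (Ordinal hj)).
- move=> k _ [hk _] l _ [hl _] i _ [hi _] j _ [hj _].
  move=> /(trace_relP k (Ordinal hi)) [h1 h2] /(trace_relP l (Ordinal hj)) [h3 h4].
  move=> /(cfP_ord (Ordinal hi) (Ordinal hj)); apply/negP/cfC; by rewrite -memC.
move=> i _ [hi _]; case hit : (Ordinal hi \in t).
  left; have hk : index (Ordinal hi) t < m by rewrite index_mem.
  exists (index (Ordinal hi) t); first exact: mz.
  split; first by split; [|exact: m_lt].
  by apply/(trace_relP _ (Ordinal hi)).
right; have [[b hlt hb]|[b hcf hb]] := max_config_ext (negbT hit).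
  exists (val b); first exact/nz/ltn_ord.
  split; first by split; [exact: ltn_ord | exact: n_lt].
  left; split; first exact/(ltP_ord b (Ordinal hi)).
  by move=> k _ _ /trace_relP [h _]; rewrite h in hb.
exists (val b); first exact/nz/ltn_ord.
split; first by split; [exact: ltn_ord | exact: n_lt].
right; split; first exact/(cfP_ord (Ordinal hi) b).
have hk : index b t < m by rewrite index_mem.
exists (index b t); first exact: mz.
split; first by split; [|exact: m_lt].
by apply/trace_relP.
Qed.

Lemma hword_take_nth k x0 : k < m -> hword E (take k.+1 t) =
  hword E (take k t) ++ [seq v <- [:: evlab E (nth x0 t k)] | v != 0].
Proof.
move=> hk; rewrite (take_nth x0) // /hword -cats1 filter_cat map_cat.
by congr (_ ++ _); rewrite /= /eps; case: eqP.
Qed.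

Lemma word_complete : sem 3 word_form z e.
Proof.
have hz := size_z; have hcfX := cf_end_lt; have hXz : X < size z by lia.
have z0 : 0 < size z by lia.
rewrite /= /upd /=; refine (conj _ (conj _ _)) => //; last first.
  move=> p hpz /(@atomP 2) -/(_ isT) /andP[_ /eqP ->].
  have hp : start (n.+1 + size (hword E (take m t))) = X.
    rewrite take_size hw -size_labels /code_start take_size.
    exact: size_codes_off drop_cf hcfX.
  by rewrite hp.
move=> k _ [hk _] i _ [hi _] s _ p _ /(trace_relP k (Ordinal hi)) [hit hik].
move=> /(@atomP 1) -/(_ isT) /andP[_ /eqP ->] /(@atomP 2) -/(_ isT) /andP[_ /eqP ->].
have hnext := hword_take_nth (Ordinal hi) hk.
have hnth : nth (Ordinal hi) t k = Ordinal hi by rewrite -hik nth_index.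
rewrite hnth [filter _ _]/= in hnext.
set j := size (hword E (take k t)) in hnext *.
have hiL : i < size L by rewrite size_labels; lia.
have hlab : nth 0 L i = evlab E (Ordinal hi) := nth_labels (Ordinal hi).
have sepP : at_ (start i) = ISep <-> evlab E (Ordinal hi) = 0.
  by rewrite -[code_start _ _ _]addn0 at_start // nth_enc_nat0 hlab.
case: (eqVneq (evlab E (Ordinal hi)) 0) hnext => /= [h0|h0] hnext; [left | right].
  split; first by apply/symW => //; apply/sepP.
  by apply/(@atomP 2) => //=; rewrite hnext cats0 hk eqxx.
split.
  rewrite symP //; last exact: code_start_le drop_cf hcfX _.
  by move/sepP => h; rewrite h in h0.
(* Cutting the trace around its event of rank [k] shows that letter [j] of the word is the label of
   this event. *)
have hsplit : w = hword E (take k t) ++ evlab E (Ordinal hi) :: hword E (drop k.+1 t).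
  rewrite -hw -{1}(cat_take_drop k.+1 t) {1}/hword filter_cat map_cat -/(hword E _).
  by rewrite -/(hword E _) hnext -catA.
have hwj : nth 0 w j = evlab E (Ordinal hi) by rewrite hsplit nth_cat ltnn subnn.
have hjL : n.+1 + j < size L.
  by rewrite size_labels hsplit size_cat /= -/j; lia.
set v := evlab E (Ordinal hi) in hlab hwj h0 hnext hsplit *.
have hd0 := size_enc_nat_gt0 v.
have hSi := code_startS cf_e.+1 hiL; rewrite hlab in hSi.
have hSj := code_startS cf_e.+1 hjL; rewrite nth_labels_word hwj in hSj.
have hleI := code_start_le drop_cf hcfX i.+1.
have hleJ := code_start_le drop_cf hcfX (n.+1 + j).+1.
have atI d : at_ (start i + d) = nth IHash (enc_nat v ++ codes (drop i.+1 L)) d.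
  by rewrite at_start // hlab.
have atJ d : at_ (start (n.+1 + j) + d) =
    nth IHash (enc_nat v ++ codes (drop (n.+1 + j).+1 L)) d.
  by rewrite at_start // nth_labels_word hwj.
(* Offset of the separator, the last symbol of the code. *)
exists (size (enc_nat v)).-1; first lia.
refine (conj _ (conj _ (conj _ (conj _ (conj _ _))))) => //.
- by split; lia.
- by apply: symW; rewrite // atI nth_enc_nat_last.
- by apply: symW; rewrite // atJ nth_enc_nat_last.
- move=> r _ [hr _]; have hr1 : r.+1 < size (enc_nat v) by lia.
  have eqIJ : at_ (start i + r) = at_ (start (n.+1 + j) + r).
    by rewrite atI atJ !nth_cat; case: ifP => //; lia.
  have := nth_enc_nat_lt (codes (drop i.+1 L)) hr1; rewrite -atI.
  by case=> h; [left | right]; split; apply: symW; rewrite // -?eqIJ h.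
apply/(@atomP 2) => //=; rewrite hnext size_cat /= -/j addn1 hk.
by rewrite addnS hSj; apply/eqP; lia.
Qed.

Lemma size_table_le : size y <= 3 * X.+1 ^ 2.
Proof. by rewrite size_mkseq -mulnA mulnn. Qed.

Lemma membership_complete : sem 0 membership_form z (fun _ => 0).
Proof.
exists X; first by have := size_z; lia.
exists n; first exact: n_lt.
exists m; first exact: m_lt.
refine (conj input_complete (conj event_complete (conj start_complete
  (conj trace_complete (conj word_complete (conj _ erefl)))))).
exact: leq_ltn_trans m_lt.
Qed.

End Complete.

Theorem theorem1 : in_NP FLES_MEMBERSHIP.
Proof.
(* The constants are those of the certificate: three square tables of side [(size x).+1]. *)
apply: (@NP_of_form _ membership_form 3 2 membership_form_wf).
  move=> _ [E [w [-> [hE [C [t [hC ht hw]]]]]]].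
  exists (table (enc_inst E w) (pos_rel w t)).
    exact: size_table_le.
  exact: (membership_complete hE hC ht hw).
move=> x y [X hX [n hn [m hm [hin hrest]]]].
(* The guessed length is forced: position [size x] carries a hash, and the sentence allows a hash
   only at [X]. *)
have eX : X = size x.
  case: hin => _ [huniq _].
  have hz : size x < size (x ++ IHash :: y) by rewrite size_cat /=; lia.
  have [|_ h] := huniq (size x) hz; last by move: h; rewrite /= /upd /=.
  by rewrite /= /upd /= nth_cat ltnn subnn.
subst X; case: hrest => hev [hst [htr [hwd _]]].
exact: membership_sound hn hm hin hev hst htr hwd.
Qed.
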